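(* Let $k$ be a field, and let $L_1,L_2$ be $L$-algebras over $k$ with $k$-bases $X=\{x_i\mid i\in I\}$ and $Y=\{y_j\mid j\in J\}$ respectively, $X$ and $Y$ disjoint, and let $X\cup Y$ be well-ordered. Write $\{x_i\prec x_j\},\{x_i\succ x_j\}$ for the products in $L_1$ expressed as linear combinations of elements of $X$, and similarly $\{y_i\prec y_j\},\{y_i\succ y_j\}$ for $L_2$ and $Y$. Put $$S_1=\{x_i\prec x_j-\{x_i\prec x_j\},\ x_i\succ x_j-\{x_i\succ x_j\}\mid i,j\in I\},$$ $$S_2=\{y_i\prec y_j-\{y_i\prec y_j\},\ y_i\succ y_j-\{y_i\succ y_j\}\mid i,j\in J\},$$ so that $L_1*L_2=L(X\cup Y|S_1\cup S_2)$ is the free product of $L_1$ and $L_2$. Let $S=S_1\cup S_2\cup F_1\cup F_2$, where $$F_1=\{x_i\succ((((x_j\prec u)\prec v_1)\prec\cdots)\prec v_n)-(((\{x_i\succ x_j\}\prec u)\prec v_1)\prec\cdots)\prec v_n\}$$ over all $i,j\in I$, $n\in\mathbb N=\{0,1,2,\dots\}$, $u\in Irr(S_1\cup S_2)\setminus X$, $v_1,\dots,v_n\in Irr(S_1\cup S_2)$, and $$F_2=\{y_i\succ((((y_j\prec u)\prec v_1)\prec\cdots)\prec v_n)-(((\{y_i\succ y_j\}\prec u)\prec v_1)\prec\cdots)\prec v_n\}$$ over all $i,j\in J$, $n\in\mathbb N$, $u\in Irr(S_1\cup S_2)\setminus Y$, $v_1,\dots,v_n\in Irr(S_1\cup S_2)$.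 Then, with the ordering on $N(X\cup Y)$ described in the context, $S$ is a Gröbner-Shirshov basis of $L_1*L_2=L(X\cup Y|S_1\cup S_2)$; that is, $S$ is a Gröbner-Shirshov basis in $L(X\cup Y)$ and $Id(S)=Id(S_1\cup S_2)$.
   Context: An $L$-algebra over $k$ is a $k$-space with two bilinear operations $\prec,\succ$ satisfying $(x\succ y)\prec z=x\succ(y\prec z)$; ideals are two-sided with respect to both operations. The free product $L_1*L_2$ is the coproduct of $L_1$ and $L_2$ in the category of $L$-algebras over $k$. For a well-ordered set $Z$ and $\Omega=\{\prec,\succ\}$: $(Z,\Omega)$ (the $\Omega$-words) is the smallest set of formal expressions containing $Z$ and closed under $u,v\mapsto u\prec v$, $u\succ v$. Normal words: $z\in Z$; $v\succ w$ with $v,w$ normal; $v\prec w$ with $v,w$ normal and $v$ not of the form $v_1\succ v_2$. $N(Z)$ is the set of normal words. The free $L$-algebra $L(Z)$ has $k$-basis $N(Z)$ and operations given for $u,v\in N(Z)$ by: $u\succ v$ is the word $u\succ v$; $u\prec v=[u\prec v]$, where $[u\prec v]$ is the word $u\prec v$ if $u\in Z$ or $u=u_1\prec u_2$, and $[u\prec v]=u_1\succ[u_2\prec v]$ if $u=u_1\succ u_2$. For $T\subset L(Z)$, $Id(T)$ is the ideal generated by $T$ and $L(Z|T)=L(Z)/Id(T)$. Ordering: $|u|$ is the number of occurrences of elements of $Z$ in $u$; $\delta_1$ denotes $\succ$, $\delta_2$ denotes $\prec$, $\delta_1<\delta_2$. Put $wt(z)=(1,z)$ for $z\in Z$ and $wt(u)=(|u|,\delta_i,u_1,u_2)$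 for $u=\delta_i(u_1,u_2)$; $u>v$ iff $wt(u)>wt(v)$ lexicographically, recursively on $|u|+|v|$. For $0\ne f\in L(Z)$, $\overline f$ is the largest normal word occurring in $f$; $f$ is monic if its coefficient is $1$. A $\star$-$\Omega$-word is an element of $(Z\cup\{\star\},\Omega)$ ($\star\notin Z$) with exactly one occurrence of $\star$. For a $\star$-$\Omega$-word $u$ and $s\in L(Z)$, the $s$-word $u|_s$ is the element of $L(Z)$ obtained by substituting $s$ for $\star$. It is a normal $s$-word if the $\Omega$-word $u|_{\overline s}$ (formal substitution) lies in $N(Z)$. For a monic set $T\subset L(Z)$, $Irr(T)=\{u\in N(Z)\mid u\ne v|_{\overline s}\text{ for all } s\in T\text{ and normal } s\text{-words } v|_s\}$. Compositions for monic $f,g\in L(Z)$: (1) if $\overline f=u_1\succ u_2$ with $u_1,u_2\in N(Z)$, then for any $v\in N(Z)$, $f\prec v$ is a composition of right multiplication. (2) If $w=\overline f=u|_{\overline g}$ with $u|_g$ a normal $g$-word, then $(f,g)_w=f-u|_g$ is a composition of inclusion. For a monic set $T$ and $f,g\in T$: $f\prec v$ is trivial modulo $T$ if $f\prec v=\sum\alpha_iu_i|_{s_i}$ (finite sum) with $\alpha_i\in k$, $s_i\in T$, $u_i|_{s_i}$ normal $s_i$-words and $u_i|_{\overline{s_i}}\le\overline{f\prec v}$; $(f,g)_w$ is trivial modulo $(T,w)$ if it is such a sum with $u_i|_{\overline{s_i}}<w$ for all $i$. $T$ is a Gröbner-Shirshov basis in $L(Z)$ if all compositions of elements of $T$ are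 trivial. *)

(* Defs.v *)
From HB Require Import structures.
From mathcomp Require Import all_boot all_order all_algebra.
From mathcomp Require Import finmap monalg boolp wochoice.

Set Implicit Arguments.
Unset Strict Implicit.
Unset Printing Implicit Defensive.

Import GRing.Theory.

Local Open Scope ring_scope.
Local Open Scope quotient_scope.

Declare Scope lalg_scope.
Delimit Scope lalg_scope with L.

HB.mixin Record Lmodule_isLAlgebra (k : fieldType) L of GRing.Lmodule k L := {
  lprec : L -> L -> L;
  lsucc : L -> L -> L;
  lprec_linearl : forall y, linear (lprec^~ y);
  lprec_linearr : forall x, linear (lprec x);
  lsucc_linearl : forall y, linear (lsucc^~ y);
  lsucc_linearr : forall x, linear (lsucc x);
  lsucc_lprecA : forall x y z, lprec (lsucc x y) z = lsucc x (lprec y z)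
}.

#[short(type="lalgebraType")]
HB.structure Definition LAlgebra (k : fieldType) :=
  { L of GRing.Lmodule k L & Lmodule_isLAlgebra k L }.

Notation "x ≺ y" := (lprec x y) (at level 45, no associativity) : lalg_scope.
Notation "x ≻ y" := (lsucc x y) (at level 45, no associativity) : lalg_scope.
Local Open Scope lalg_scope.

Section LAlgebraTheory.
Context (k : fieldType).

Definition is_lalg_hom (A B : lalgebraType k) (f : A -> B) : Prop :=
  [/\ linear f, {morph f : x y / x ≺ y} & {morph f : x y / x ≻ y}].

Definition is_coproduct (A B P : lalgebraType k) (iA : A -> P) (iB : B -> P) :
    Prop :=
  [/\ is_lalg_hom iA, is_lalg_hom iB &
    forall (C : lalgebraType k) (f : A -> C) (g : B -> C),
      is_lalg_hom f -> is_lalg_hom g ->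
      exists h : P -> C,
        [/\ is_lalg_hom h, h \o iA =1 f, h \o iB =1 g &
          forall h' : P -> C, is_lalg_hom h' ->
            h' \o iA =1 f -> h' \o iB =1 g -> h' =1 h]].

Definition is_ideal (A : lalgebraType k) (D : A -> Prop) : Prop :=
  [/\ D 0, forall (a : k) f g, D f -> D g -> D (a *: f + g) &
    forall f g, D f -> [/\ D (f ≺ g), D (g ≺ f), D (f ≻ g) & D (g ≻ f)]].

Definition Id (A : lalgebraType k) (T : A -> Prop) (f : A) : Prop :=
  forall D : A -> Prop, is_ideal D -> (forall t, T t -> D t) -> D f.

Lemma Id_ideal (A : lalgebraType k) (T : A -> Prop) : is_ideal (Id T).
Proof.
split=> [D [] //|a f g If Ig D DI TD|f g If].
  by case: (DI) => _ DL _; apply: DL; [apply: If|apply: Ig].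
split=> D DI TD; case: (DI) => _ _ /(_ f g (If D DI TD)) [] //.
Qed.

(* c : {malg k[I]} is a finitely supported family of coefficients. *)
Definition lincomb (I : choiceType) (V : lmodType k) (x : I -> V)
    (c : {malg k[I]}) : V :=
  \sum_(i <- msupp c) c@_i *: x i.

Definition is_basis (I : choiceType) (V : lmodType k) (x : I -> V) : Prop :=
  forall v, exists! c, lincomb x c = v.

Lemma lincombEw (I : choiceType) (V : lmodType k) (x : I -> V)
    (c : {malg k[I]}) (d : {fset I}) :
  (msupp c `<=` d)%fset -> lincomb x c = \sum_(i <- d) c@_i *: x i.
Proof.
move=> cd; rewrite /lincomb (big_fset_incl _ cd) // => i _ /mcoeff_outdom ->.
by rewrite scale0r.
Qed.

Lemma lincomb_linear (I : choiceType) (V : lmodType k) (x : I -> V) :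
  linear (lincomb x).
Proof.
move=> a f g; pose d := (msupp f `|` msupp g `|` msupp (a *: f + g))%fset.
rewrite !(@lincombEw _ _ x _ d).
- rewrite scaler_sumr -big_split; apply: eq_bigr => i _ /=.
  by rewrite mcoeffD mcoeffZ scalerDl scalerA.
- by rewrite /d -fsetUA fsetUCA fsubsetUl.
- by rewrite /d -fsetUA fsubsetUl.
- exact: fsubsetUr.
Qed.

Lemma lincombU (I : choiceType) (V : lmodType k) (x : I -> V) i :
  lincomb x << i >> = x i.
Proof.
by rewrite /lincomb msuppU oner_eq0 big_seq_fset1 mcoeffUU scale1r.
Qed.

Lemma linear_ext (I : choiceType) (V : lmodType k) (f g : {malg k[I]} -> V) :
  linear f -> linear g -> (forall i, f << i >> = g << i >>) -> f =1 g.
Proof.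
move=> lf lg fg c.
rewrite (monalgE c).
have fgU i : f << c@_i *g i >> = g << c@_i *g i >>.
  have -> : << c@_i *g i >> = c@_i *: << i >> :> {malg k[I]}.
    by apply/malgP => j; rewrite mcoeffZ !mcoeffU mulrnAr mulr1.
  by rewrite (scalable_linear lf) (scalable_linear lg) fg.
apply: (big_ind (fun h => f h = g h)) => [|u v fu fv|i _]; last exact: fgU.
  by rewrite -(scale0r 0) (scalable_linear lf) (scalable_linear lg) /= !scale0r.
by rewrite -[u]scale1r lf lg fu fv.
Qed.

End LAlgebraTheory.

Section Quotient.
Context (k : fieldType) (A : lalgebraType k) (T : A -> Prop).

Definition Id_eq : rel A := fun f g => `[< Id T (f - g) >].

Let IdP : is_ideal (Id T) := Id_ideal T.

Let IdD f g : Id T f -> Id T g -> Id T (f + g).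
Proof. by case: IdP => _ H _ If Ig; rewrite -[f]scale1r; apply: H. Qed.

Let IdZ a f : Id T f -> Id T (a *: f).
Proof. by case: IdP => I0 H _ If; rewrite -[_ *: _]addr0; apply: H. Qed.

Lemma Id_eq_equiv : equiv_class_of Id_eq.
Proof.
split=> [f|f g|g f h].
- by apply/asboolP; rewrite subrr; case: IdP.
- by apply/asboolP/asboolP => /(IdZ (-1)); rewrite scaleN1r opprB.
- by move=> /asboolP fg /asboolP gh; apply/asboolP; rewrite -[f](subrK g) -addrA;
    apply: IdD.
Qed.

Canonical Id_eqrel := EquivRelPack Id_eq_equiv.

Definition lquot : Type := {eq_quot Id_eq}.
HB.instance Definition _ := Choice.on lquot.
HB.instance Definition _ := EqQuotient.on lquot.

Definition lquot_pi (f : A) : lquot := \pi_lquot f.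

Lemma lquot_piP f g : lquot_pi f = lquot_pi g <-> Id T (f - g).
Proof.
split=> [/(@eqquotP _ Id_eqrel lquot _ _)/asboolP //|fg].
by apply/(@eqquotP _ Id_eqrel lquot _ _)/asboolP.
Qed.

Let lreprP f : Id T (repr (lquot_pi f) - f).
Proof. by apply/lquot_piP; rewrite /lquot_pi reprK. Qed.

Let lquotW (P : lquot -> Prop) : (forall f, P (lquot_pi f)) -> forall q, P q.
Proof. by move=> H; elim/quotW. Qed.

Let qadd (p q : lquot) := lquot_pi (repr p + repr q).
Let qopp (p : lquot) := lquot_pi (- repr p).
Let qscale (a : k) (p : lquot) := lquot_pi (a *: repr p).
Let qprec (p q : lquot) := lquot_pi (repr p ≺ repr q).
Let qsucc (p q : lquot) := lquot_pi (repr p ≻ repr q).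

Let qaddE f g : qadd (lquot_pi f) (lquot_pi g) = lquot_pi (f + g).
Proof. by apply/lquot_piP; rewrite opprD addrACA; apply: IdD. Qed.

Let qoppE f : qopp (lquot_pi f) = lquot_pi (- f).
Proof.
by apply/lquot_piP; rewrite -opprD -scaleN1r; apply: IdZ.
Qed.

Let qscaleE a f : qscale a (lquot_pi f) = lquot_pi (a *: f).
Proof. by apply/lquot_piP; rewrite -scalerBr; apply: IdZ. Qed.

Let lin_sub (h : A -> A) : linear h -> forall f g, h f - h g = h (f - g).
Proof. by move=> lh f g; rewrite addrC -scaleN1r -lh scaleN1r addrC. Qed.

Let op2E (op : A -> A -> A) f g :
    (forall y, linear (op^~ y)) -> (forall x, linear (op x)) ->
    (forall s t, Id T s -> Id T (op s t) /\ Id T (op t s)) ->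
  lquot_pi (op (repr (lquot_pi f)) (repr (lquot_pi g))) = lquot_pi (op f g).
Proof.
move=> ll lr opI; apply/lquot_piP; set f' := repr _; set g' := repr _.
rewrite -[op f' g'](subrK (op f g')) -addrA.
rewrite (lin_sub (ll g')) (lin_sub (lr f)); apply: IdD.
  by apply: (opI _ _ _).1; exact: lreprP.
by apply: (opI _ _ _).2; exact: lreprP.
Qed.

Let qprecE f g : qprec (lquot_pi f) (lquot_pi g) = lquot_pi (f ≺ g).
Proof.
apply: op2E => [y|x|s t Is]; [exact: lprec_linearl|exact: lprec_linearr|].
by case: IdP => _ _ /(_ s t Is) [].
Qed.

Let qsuccE f g : qsucc (lquot_pi f) (lquot_pi g) = lquot_pi (f ≻ g).
Proof.
apply: op2E => [y|x|s t Is]; [exact: lsucc_linearl|exact: lsucc_linearr|].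
by case: IdP => _ _ /(_ s t Is) [].
Qed.

Let qaddA : associative qadd.
Proof.
by elim/lquotW => f; elim/lquotW => g; elim/lquotW => h; rewrite !qaddE addrA.
Qed.

Let qaddC : commutative qadd.
Proof. by elim/lquotW => f; elim/lquotW => g; rewrite !qaddE addrC. Qed.

Let qadd0 : left_id (lquot_pi 0) qadd.
Proof. by elim/lquotW => f; rewrite !qaddE add0r. Qed.

Let qaddN : left_inverse (lquot_pi 0) qopp qadd.
Proof. by elim/lquotW => f; rewrite qoppE !qaddE addNr. Qed.

HB.instance Definition _ :=
  GRing.isZmodule.Build lquot qaddA qaddC qadd0 qaddN.

Let qpiD f g : lquot_pi f + lquot_pi g = lquot_pi (f + g).
Proof. exact: qaddE. Qed.

Let qscaleA a b p : qscale a (qscale b p) = qscale (a * b) p.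
Proof. by elim/lquotW: p => f; rewrite !qscaleE scalerA. Qed.

Let qscale1 : left_id 1 qscale.
Proof. by elim/lquotW => f; rewrite !qscaleE scale1r. Qed.

Let qscaleDr : right_distributive qscale +%R.
Proof.
by move=> a; elim/lquotW => f; elim/lquotW => g; rewrite !(qpiD, qscaleE) scalerDr.
Qed.

Let qscaleDl p : {morph qscale^~ p : a b / a + b}.
Proof. by elim/lquotW: p => f a b; rewrite !(qpiD, qscaleE) scalerDl. Qed.

HB.instance Definition _ :=
  GRing.Zmodule_isLmodule.Build k lquot qscaleA qscale1 qscaleDr qscaleDl.

Lemma lquot_pi_linear : linear lquot_pi.
Proof. by move=> a f g; rewrite -qpiD; congr (_ + _); rewrite -qscaleE. Qed.

Let qprec_linearl q : linear (qprec^~ q).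
Proof.
move=> a; elim/lquotW: q => h; elim/lquotW => f; elim/lquotW => g.
by rewrite -lquot_pi_linear !qprecE -lquot_pi_linear lprec_linearl.
Qed.

Let qprec_linearr q : linear (qprec q).
Proof.
move=> a; elim/lquotW: q => h; elim/lquotW => f; elim/lquotW => g.
by rewrite -lquot_pi_linear !qprecE -lquot_pi_linear lprec_linearr.
Qed.

Let qsucc_linearl q : linear (qsucc^~ q).
Proof.
move=> a; elim/lquotW: q => h; elim/lquotW => f; elim/lquotW => g.
by rewrite -lquot_pi_linear !qsuccE -lquot_pi_linear lsucc_linearl.
Qed.

Let qsucc_linearr q : linear (qsucc q).
Proof.
move=> a; elim/lquotW: q => h; elim/lquotW => f; elim/lquotW => g.
by rewrite -lquot_pi_linear !qsuccE -lquot_pi_linear lsucc_linearr.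
Qed.

Let qsucc_qprecA p q r : qprec (qsucc p q) r = qsucc p (qprec q r).
Proof.
elim/lquotW: p => f; elim/lquotW: q => g; elim/lquotW: r => h.
by rewrite !(qprecE, qsuccE) lsucc_lprecA.
Qed.

HB.instance Definition _ := Lmodule_isLAlgebra.Build k lquot
  qprec_linearl qprec_linearr qsucc_linearl qsucc_linearr qsucc_qprecA.

Lemma lquot_pi_hom : is_lalg_hom lquot_pi.
Proof.
split=> [|f g|f g]; [exact: lquot_pi_linear|exact/esym/qprecE|exact/esym/qsuccE].
Qed.

End Quotient.

Variant oper := Succ | Prec.

Inductive word (Z : Type) := Letter of Z | Node of oper & word Z & word Z.

Fixpoint word_tree (Z : Type) (u : word Z) : GenTree.tree Z :=
  match u with
  | Letter z => GenTree.Leaf z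
  | Node Succ u v => GenTree.Node 0 [:: word_tree u; word_tree v]
  | Node Prec u v => GenTree.Node 1 [:: word_tree u; word_tree v]
  end.

Fixpoint tree_word (Z : Type) (t : GenTree.tree Z) : option (word Z) :=
  match t with
  | GenTree.Leaf z => Some (Letter z)
  | GenTree.Node n [:: t1; t2] =>
      if tree_word t1 is Some u then
        if tree_word t2 is Some v then
          Some (Node (if n is 0 then Succ else Prec) u v)
        else None
      else None
  | _ => None
  end.

Lemma word_treeK (Z : Type) : pcancel (@word_tree Z) (@tree_word Z).
Proof. by elim=> [//|[] u IHu v IHv] /=; rewrite IHu IHv. Qed.

HB.instance Definition _ (Z : eqType) :=
  Equality.copy (word Z) (pcan_type (@word_treeK Z)).
HB.instance Definition _ (Z : choiceType) :=
  Choice.copy (word Z) (pcan_type (@word_treeK Z)).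

Fixpoint letters (Z : Type) (u : word Z) : seq Z :=
  match u with
  | Letter z => [:: z]
  | Node _ u v => letters u ++ letters v
  end.

Definition wlen (Z : Type) (u : word Z) : nat := size (letters u).

Definition is_succ (Z : Type) (u : word Z) : bool :=
  if u is Node Succ _ _ then true else false.

Fixpoint normal (Z : Type) (u : word Z) : bool :=
  match u with
  | Letter _ => true
  | Node Succ v w => normal v && normal w
  | Node Prec v w => [&& normal v, normal w & ~~ is_succ v]
  end.

Record nword (Z : Type) := NWord {nword_val :> word Z; _ : normal nword_val}.

HB.instance Definition _ (Z : Type) := [isSub for @nword_val Z].
HB.instance Definition _ (Z : eqType) := [Equality of nword Z by <:].
HB.instance Definition _ (Z : choiceType) := [Choice of nword Z by <:].

Fixpoint bracket (Z : Type) (u v : word Z) : word Z :=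
  match u with
  | Node Succ u1 u2 => Node Succ u1 (bracket u2 v)
  | _ => Node Prec u v
  end.

Lemma normal_succ (Z : Type) (u v : nword Z) : normal (Node Succ u v).
Proof. by case: u v => u nu [v nv] /=; rewrite nu. Qed.

Lemma normal_bracket (Z : Type) (u v : nword Z) : normal (bracket u v).
Proof.
case: u v => u nu [v nv] /=; elim: u nu => [z _|[] u1 _ u2 IH] /=.
- by rewrite nv.
- by case/andP => -> /IH.
- by move=> ->; rewrite nv.
Qed.

Definition nletter (Z : Type) (z : Z) : nword Z :=
  @NWord Z (Letter z) isT.
Definition nsucc (Z : Type) (u v : nword Z) : nword Z :=
  NWord (normal_succ u v).
Definition nprec (Z : Type) (u v : nword Z) : nword Z :=
  NWord (normal_bracket u v).

Section Free.
Context (k : fieldType) (Z : choiceType).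

Definition free_lalg : Type := {malg k[nword Z]}.
HB.instance Definition _ := GRing.Lmodule.on free_lalg.

Definition fword (u : nword Z) : free_lalg := << u >>.

Definition bilin_ext (op : nword Z -> nword Z -> nword Z) (f g : free_lalg) :
    free_lalg :=
  lincomb (fun u => lincomb (fun v => fword (op u v)) g) f.

Definition fprec := bilin_ext (@nprec Z).
Definition fsucc := bilin_ext (@nsucc Z).

Let bilin_extl op g : linear (bilin_ext op ^~ g).
Proof. exact: lincomb_linear. Qed.

Let bilin_extr op f : linear (bilin_ext op f).
Proof.
move=> a g h; rewrite /bilin_ext {1 3 5}/lincomb scaler_sumr -big_split /=.
apply: eq_bigr => u _.
by rewrite lincomb_linear scalerDr !scalerA [_ * a]mulrC.
Qed.

Let bilin_extU op u v : bilin_ext op (fword u) (fword v) = fword (op u v).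
Proof. by rewrite /bilin_ext !lincombU. Qed.

Let comp_linear (f g : free_lalg -> free_lalg) :
  linear f -> linear g -> linear (fun x => f (g x)).
Proof. by move=> lf lg a x y; rewrite lg lf. Qed.

Let fsucc_fprecA f g h : fprec (fsucc f g) h = fsucc f (fprec g h).
Proof.
move: f; apply: linear_ext.
- exact: (comp_linear (bilin_extl _ _) (bilin_extl _ _)).
- exact: bilin_extl.
move=> u; move: g; apply: linear_ext.
- exact: (comp_linear (bilin_extl _ _) (bilin_extr _ _)).
- exact: (comp_linear (bilin_extr _ _) (bilin_extl _ _)).
move=> v; move: h; apply: linear_ext.
- exact: bilin_extr.
- exact: (comp_linear (bilin_extr _ _) (bilin_extr _ _)).
move=> w; rewrite /fprec /fsucc -!/(fword _) !bilin_extU.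
by congr fword; apply: val_inj.
Qed.

HB.instance Definition _ := Lmodule_isLAlgebra.Build k free_lalg
  (bilin_extl (@nprec Z)) (bilin_extr (@nprec Z))
  (bilin_extl (@nsucc Z)) (bilin_extr (@nsucc Z)) fsucc_fprecA.

Lemma fword_succ u v : fword u ≻ fword v = fword (nsucc u v).
Proof. exact: bilin_extU. Qed.

Lemma fword_prec u v : fword u ≺ fword v = fword (nprec u v).
Proof. exact: bilin_extU. Qed.

Definition fletter (z : Z) : free_lalg := fword (nletter z).

End Free.

Arguments fword {k Z} u.
Arguments fletter {k Z} z.

(* The letter None of option Z plays the role of the extra letter star. *)
Definition star_word (Z : eqType) (u : word (option Z)) : bool :=
  count_mem None (letters u) == 1%N.

Fixpoint wsubst (Z : Type) (u : word (option Z)) (w : word Z) : word Z :=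
  match u with
  | Letter (Some z) => Letter z
  | Letter None => w
  | Node d u v => Node d (wsubst u w) (wsubst v w)
  end.

Fixpoint sword (k : fieldType) (Z : choiceType) (u : word (option Z))
    (s : free_lalg k Z) : free_lalg k Z :=
  match u with
  | Letter (Some z) => fletter z
  | Letter None => s
  | Node Succ u v => sword u s ≻ sword v s
  | Node Prec u v => sword u s ≺ sword v s
  end.

Section GroebnerShirshov.
Context (k : fieldType) (Z : choiceType) (leZ : rel Z).

Definition oper_lt (d e : oper) : bool :=
  match d, e with Succ, Prec => true | _, _ => false end.

Definition oper_eq (d e : oper) : bool :=
  match d, e with Succ, Succ | Prec, Prec => true | _, _ => false end.

(* A letter has length 1 and any other word has length at least 2. *)
Fixpoint word_lt (u v : word Z) : bool :=
  match u, v with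
  | Letter a, Letter b => (a != b) && leZ a b
  | Letter _, Node _ _ _ => true
  | Node _ _ _, Letter _ => false
  | Node d u1 u2, Node e v1 v2 =>
      (wlen u < wlen v)%N ||
      (wlen u == wlen v) &&
        (oper_lt d e ||
         oper_eq d e &&
           (word_lt u1 v1 || (u1 == v1) && word_lt u2 v2))
  end.

Definition word_le (u v : word Z) : bool := (u == v) || word_lt u v.

Local Notation L := (free_lalg k Z).

(* w is the leading word of f; no w is when f = 0. *)
Definition is_lead (f : L) (w : nword Z) : Prop :=
  w \in msupp f /\ forall w', w' \in msupp f -> word_le w' w.

Definition monic (f : L) : Prop := exists2 w, is_lead f w & f@_w = 1.

(* u|_s is a normal s-word whose word u|_(leading word of s) is w; normality
   is the membership of w in nword Z. *)
Definition normal_sword (u : word (option Z)) (s : L) (w : nword Z) : Prop :=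
  star_word u /\ exists2 sb, is_lead s sb & wsubst u sb = w.

Definition Irr (T : L -> Prop) (w : nword Z) : Prop :=
  forall u s, T s -> ~ normal_sword u s w.

Definition sword_sum (T : L -> Prop) (bound : nword Z -> Prop) (h : L) : Prop :=
  exists r : seq (k * word (option Z) * L),
    (forall p, p \in r ->
       T p.2 /\ exists2 w, normal_sword p.1.2 p.2 w & bound w) /\
    h = \sum_(p <- r) p.1.1 *: sword p.1.2 p.2.

Definition GS_basis (T : L -> Prop) : Prop :=
  [/\ forall f, T f -> monic f,
      forall f u1 u2 v, T f -> is_lead f (nsucc u1 u2) ->
        sword_sum T (fun w => exists2 m, is_lead (f ≺ fword v) m & word_le w m)
          (f ≺ fword v) &
      forall f g u w, T f -> T g -> is_lead f w -> normal_sword u g w ->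
        sword_sum T (fun w' => word_lt w' w) (f - sword u g)].

End GroebnerShirshov.

Section Relations.
Context (k : fieldType) (A : lalgebraType k) (I Z : choiceType).
Context (x : I -> A) (e : I -> Z).

Local Notation X i := (fletter (e i) : free_lalg k Z).

(* In both definitions c is the coordinate family of a product of two basis
   elements, so lincomb _ c is that product rewritten in L(Z). *)
Definition table_rel (f : free_lalg k Z) : Prop :=
  exists i j c,
    lincomb x c = x i ≺ x j /\ f = (X i ≺ X j) - lincomb (fun l => X l) c \/
    lincomb x c = x i ≻ x j /\ f = (X i ≻ X j) - lincomb (fun l => X l) c.

(* vs lists v_1, ..., v_n *)
Definition prec_rel (P : nword Z -> Prop) (f : free_lalg k Z) : Prop :=
  exists i j c (u : nword Z) (vs : seq (nword Z)),
    [/\ lincomb x c = x i ≻ x j,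
        P u,
        forall l, u <> nletter (e l),
        forall v, v \in vs -> P v &
        f = (X i ≻ foldl lprec (X j ≺ fword u) (map fword vs))
            - foldl lprec (lincomb (fun l => X l) c ≺ fword u) (map fword vs)].

End Relations.

Section FreeProduct.
Context (k : fieldType) (L1 L2 : lalgebraType k) (I J : choiceType).
Context (x : I -> L1) (y : J -> L2) (le : rel (I + J)%type).

Local Notation L := (free_lalg k (I + J)%type).

Definition S_1 : L -> Prop := table_rel x inl.
Definition S_2 : L -> Prop := table_rel y inr.
Definition S_12 (f : L) : Prop := S_1 f \/ S_2 f.
Definition F_1 : L -> Prop := prec_rel x inl (Irr le S_12).
Definition F_2 : L -> Prop := prec_rel y inr (Irr le S_12).
Definition S_all (f : L) : Prop := [\/ S_1 f, S_2 f, F_1 f | F_2 f].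

(* L(X u Y | S_1 u S_2), with x_i and y_j sent to the classes of the
   corresponding letters, is the coproduct of L1 and L2. *)
Definition presents_free_product : Prop :=
  exists (i1 : L1 -> lquot S_12) (i2 : L2 -> lquot S_12),
    [/\ forall i, i1 (x i) = lquot_pi S_12 (fletter (inl i)),
        forall j, i2 (y j) = lquot_pi S_12 (fletter (inr j)) &
        is_coproduct i1 i2].

End FreeProduct.

(* Main.v *)
From HB Require Import structures.
Require Import Defs.
From mathcomp Require Import all_boot all_order all_algebra.
From mathcomp Require Import finmap monalg boolp wochoice.

(** Every relation s in S has the form (normal word) - (combination of strictly
    shorter words), and lengths add up under both products of L(Z). Hence the
    leading word of s is read off from lengths alone, every normal s-word is
    again a word plus strictly shorter words, and all the bounds required from
    the compositions reduce to comparisons of lengths, together with equality in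
    the one place where a bound is attained ([lead], [nsw_lead],
    [word_lt_wlen]).

    Call letters of the same factor letters of the same colour. For letters a, b
    of one colour and any list ws = w_1, ..., w_n of normal words put
      srel a b ws = a ≻ ((b ≺ w_1) ≺ ... ≺ w_n)
                    - (({a ≻ b} ≺ w_1) ≺ ... ≺ w_n).
    For ws empty this is a relation of S_1 or S_2; for w_1 not a letter of that
    colour and all w_i irreducible it is an element of F_1 or F_2. By
    (x ≻ y) ≺ z = x ≻ (y ≺ z) it is always (a ≻ b - {a ≻ b}) ≺ w_1 ≺ ... ≺ w_n,
    which shows that F_1 and F_2 lie in the ideal of S_1 and S_2
    ([Id_completion]).

    The heart of the proof is [srel_trivial]: for arbitrary ws, srel a b ws is a
    sum of normal S-words bounded by its own leading word. It goes by induction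
    on length. If ws is admissible, srel a b ws is in S. If some w_i is
    reducible, one of its normal s-words replaces it: the two resulting terms
    are normal s-words (one of them attains the bound), and what remains is a
    combination of srel a b ws' with ws' shorter ([srel_replace]). If w_1 is a
    letter c of the colour of a and b, rewriting b ≺ c on one side and the
    letters of {a ≻ b} ≺ c on the other reduces to relations srel a l ws', and
    the leftovers cancel because {a ≻ b} ≺ c = a ≻ {b ≺ c} in the factor
    ([srel_letter]).

    Compositions of right multiplication are then immediate, as
    srel a b ws ≺ v = srel a b (ws, v). For a composition of inclusion, either
    the two leading words coincide, and then so do the two relations
    ([completion_inj]), or the inner leading word lies inside one of the w_i:
    the positions at a prefix of the chain b ≺ w_1 ≺ ... are excluded by
    admissibility ([nsw_nchain], [admissible_split]). Then [srel_replace] and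
    [srel_trivial] conclude.

    The coproduct property is formal: the maps from the factors are read off
    in coordinates, and a pair of homomorphisms out of the factors extends to
    L(X u Y) by evaluation and kills the two multiplication tables. *)

Set Implicit Arguments.
Unset Strict Implicit.
Unset Printing Implicit Defensive.

Import GRing.Theory.
Local Open Scope ring_scope.
Local Open Scope lalg_scope.

(** * Linear maps and linear combinations *)

Section LinearProp.
Context (k : fieldType) (U V : lmodType k) (f : U -> V).
Hypothesis lf : linear f.
Let F : {linear U -> V} := HB.pack f (GRing.isLinear.Build k U V *:%R f lf).

Lemma lin0 : f 0 = 0. Proof. exact: (linear0 F). Qed.
Lemma linB u v : f (u - v) = f u - f v. Proof. exact: (linearB F). Qed.

Lemma lin_lincomb (K : choiceType) (x : K -> U) c :
  f (lincomb x c) = lincomb (f \o x) c.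
Proof.
apply: etrans (linear_sum F _ _ _) _.
by apply: eq_bigr => i _; apply: scalable_linear lf _ _.
Qed.

Lemma linear_comp (W : lmodType k) (g : W -> U) : linear g -> linear (f \o g).
Proof. by move=> lg a u v /=; rewrite lg lf. Qed.

End LinearProp.

Section Lincomb.
Context (k : fieldType) (V : lmodType k) (K : choiceType).

Lemma eq_lincomb (x y : K -> V) c :
  (forall i, i \in msupp c -> x i = y i) -> lincomb x c = lincomb y c.
Proof.
by move=> xy; rewrite /lincomb !big_seq; apply: eq_bigr => i ic; rewrite xy.
Qed.

Lemma lincombB (x y : K -> V) c :
  lincomb x c - lincomb y c = lincomb (fun i => x i - y i) c.
Proof.
by rewrite /lincomb -sumrB; apply: eq_bigr => i _; rewrite scalerBr.
Qed.

Lemma lincomb_lincomb (K' : choiceType) (x : K -> V) (d : K' -> {malg k[K]}) c :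
  lincomb x (lincomb d c) = lincomb (fun i => lincomb x (d i)) c.
Proof. exact/lin_lincomb/lincomb_linear. Qed.

Lemma lincomb_id (c : {malg k[K]}) : lincomb (fun i => << i >>) c = c.
Proof.
apply: (linear_ext (g := fun c => c)) => [||i] //; first exact: lincomb_linear.
exact: lincombU.
Qed.

Lemma msupp_lincombU (K' : choiceType) (e : K' -> K) (c : {malg k[K']}) l :
  l \in msupp (lincomb (fun i => << e i >>) c : {malg k[K]}) ->
  exists2 i, i \in msupp c & l = e i.
Proof.
rewrite -mcoeff_neq0 /lincomb raddf_sum /= => nz.
apply: contrapT => no; case/eqP: nz; rewrite big_seq big1 // => i ic.
rewrite mcoeffZ mcoeffU; case: eqP => [ei|_]; last by rewrite mulr0n mulr0.
by case: no; exists i.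
Qed.

End Lincomb.

(** * Normal words and their lengths *)

Arguments wlen : simpl never.

Section Words.
Context (Z : choiceType).
Implicit Types (z : Z) (u v w : nword Z).

Lemma wlen_gt0 (T : Type) (u : word T) : (0 < wlen u)%N.
Proof.
elim: u => // d u IHu v _.
by rewrite /wlen /= size_cat addn_gt0; apply/orP; left.
Qed.

Lemma wlen_Node d (u v : word Z) : wlen (Node d u v) = (wlen u + wlen v)%N.
Proof. by rewrite /wlen /= size_cat. Qed.

Lemma wlen_nsucc u v : wlen (nsucc u v) = (wlen u + wlen v)%N.
Proof. exact: wlen_Node. Qed.

Lemma wlen_nprec u v : wlen (nprec u v) = (wlen u + wlen v)%N.
Proof.
rewrite /=; elim: (nword_val u) => [z|[] u1 _ u2 IH] /=; rewrite !wlen_Node //.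
by rewrite IH addnA.
Qed.

Lemma nprecE u v : ~~ is_succ u -> nword_val (nprec u v) = Node Prec u v.
Proof. by case: u => -[z|[]]. Qed.

(** Case analysis on the head of a normal word cannot be done on the subtype
    directly; this and [nword_Prec] return the subterms as normal words. *)
Lemma nword_Succ (u v : word Z) (n : normal (Node Succ u v)) :
  exists nu nv, [/\ NWord n = nsucc nu nv, nword_val nu = u & nword_val nv = v].
Proof.
case/andP: (n) => nu nv; exists (NWord nu), (NWord nv).
by split=> //; apply: val_inj.
Qed.

Lemma nword_Prec (u v : word Z) (n : normal (Node Prec u v)) :
  exists nu nv, [/\ NWord n = nprec nu nv, nword_val nu = u, nword_val nv = v
    & ~~ is_succ nu].
Proof.
case/and3P: (n) => nu nv us; exists (NWord nu), (NWord nv); split=> //.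
by apply: val_inj; exact/esym/(@nprecE (NWord nu) (NWord nv)).
Qed.

Lemma nsucc_inj u v u' v' : nsucc u v = nsucc u' v' -> u = u' /\ v = v'.
Proof. by move/(congr1 val) => /= [uu vv]; split; apply: val_inj. Qed.

(** [nprec] is not injective in general, since it pushes its second argument to
    the right through the [Succ] nodes of the first one. *)
Lemma nprec_inj u v u' v' : ~~ is_succ u -> ~~ is_succ u' ->
  nprec u v = nprec u' v' -> u = u' /\ v = v'.
Proof.
move=> nu nu' /(congr1 (@nword_val Z)); rewrite !nprecE // => -[uu vv].
by split; apply: val_inj.
Qed.

Lemma nsucc_neq_nprec u v u' v' : ~~ is_succ u' -> nsucc u v <> nprec u' v'.
Proof. by move=> nu' /(congr1 (@nword_val Z)); rewrite nprecE. Qed.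

Lemma letter_neq_nsucc z u v : nletter z <> nsucc u v.
Proof. by move/(congr1 val). Qed.

Lemma letter_neq_nprec z u v : nletter z <> nprec u v.
Proof.
move/(congr1 (fun w => wlen (nword_val w))); rewrite wlen_nprec.
case: (wlen u) (wlen_gt0 u) (wlen v) (wlen_gt0 v) => // n _ [] // m _.
by rewrite addnS.
Qed.

Definition nchain w ws : nword Z := foldl (@nprec Z) w ws.

Lemma nchain_rcons w ws v : nchain w (rcons ws v) = nprec (nchain w ws) v.
Proof. by rewrite /nchain foldl_rcons. Qed.

Lemma wlen_nchain w ws :
  wlen (nchain w ws) = (wlen w + sumn [seq wlen (nword_val v) | v <- ws])%N.
Proof.
elim/last_ind: ws => [|ws v IH]; first by rewrite addn0.
by rewrite nchain_rcons wlen_nprec IH map_rcons sumn_rcons addnA.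
Qed.

Lemma nchain_nsucc w ws : ~~ is_succ w -> ~~ is_succ (nchain w ws).
Proof.
move=> nw; elim/last_ind: ws => // ws v IH.
by rewrite nchain_rcons nprecE.
Qed.

Lemma nchain_letter_inj z z' ws ws' :
  nchain (nletter z) ws = nchain (nletter z') ws' -> z = z' /\ ws = ws'.
Proof.
elim/last_ind: ws ws' => [|ws v IH] ws'; case/lastP: ws' => [|ws' v'].
- by move/(congr1 val) => [].
- by rewrite nchain_rcons => /letter_neq_nprec.
- by rewrite nchain_rcons => /esym/letter_neq_nprec.
by rewrite !nchain_rcons => /nprec_inj[||/IH[-> ->] ->] //; apply: nchain_nsucc.
Qed.

Variable le : rel Z.

Lemma word_lt_wlen (u v : word Z) : (wlen u < wlen v)%N -> word_lt le u v.
Proof.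
case: u v => [a|d u1 u2] [b|e v1 v2] //= uv; last by rewrite uv.
by move: uv; rewrite wlen_Node ltnS leqn0 addn_eq0 (gtn_eqF (wlen_gt0 u1)).
Qed.

Lemma wlen_word_lt (u v : word Z) : word_lt le u v -> (wlen u <= wlen v)%N.
Proof.
case: u v => [a|d u1 u2] [b|e v1 v2] //; first by move=> _; apply: wlen_gt0.
by case/orP => [/ltnW//|/andP[/eqP-> _]].
Qed.

End Words.

(** * Leading words detected by length *)

Section Leading.
Context (k : fieldType) (Z : choiceType).
Local Notation L := (free_lalg k Z).
Implicit Types (u v w : nword Z) (f g h s : L).

Definition short (n : nat) f : bool :=
  all (fun w : nword Z => (wlen w < n)%N) (msupp f).

Lemma shortP n f :
  reflect (forall w, w \in msupp f -> (wlen w < n)%N) (short n f).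
Proof. exact: allP. Qed.

Lemma short_lincomb (K : choiceType) (x : K -> L) (c : {malg k[K]}) n :
  (forall i, i \in msupp c -> short n (x i)) -> short n (lincomb x c).
Proof.
move=> xn; apply/shortP => w; rewrite -mcoeff_neq0 /lincomb raddf_sum /= => nz.
apply: contrapT => no; case/eqP: nz; rewrite big_seq big1 // => i ic.
rewrite mcoeffZ [X in _ * X]mcoeff_outdom ?mulr0 //.
by apply/negP => /(shortP _ _ (xn i ic)).
Qed.

Lemma short_fword n w : (wlen w < n)%N -> short n (fword w).
Proof.
by move=> wn; apply/shortP => v; rewrite msuppU oner_eq0 in_fset1 => /eqP->.
Qed.

Lemma short_linear (h : L -> L) m n f : linear h -> short m f ->
  (forall w, (wlen w < m)%N -> short n (h (fword w))) -> short n (h f).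
Proof.
move=> lh fm hn; rewrite -[f]lincomb_id lin_lincomb //.
by apply: short_lincomb => w /(shortP _ _ fm) /hn.
Qed.

(** This is stronger than [is_lead]: the leading coefficient is 1 and every other
    word is strictly shorter, not merely smaller. All relations considered here
    satisfy it, and it is preserved by the products of L(Z). *)
Definition lead f w : bool := short (wlen w) (f - fword w).

Lemma lead_mcoeff f w : lead f w -> f@_w = 1.
Proof.
move=> fw; rewrite -[f](subrK (fword w)) mcoeffD [X in X + _]mcoeff_outdom.
  by rewrite mcoeffUU add0r.
by apply/negP => /(shortP _ _ fw); rewrite ltnn.
Qed.

Lemma lead_msupp f w v : lead f w -> v \in msupp f ->
  v = w \/ (wlen v < wlen w)%N.
Proof.
move=> fw vf; case: (eqVneq v w) => [|vw]; [by left|right].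
apply: (shortP _ _ fw).
move: vf; rewrite -!mcoeff_neq0 mcoeffB mcoeffU.
by rewrite (eq_sym w) (negPf vw) subr0.
Qed.

Lemma lead_is_lead (le : rel Z) f w : lead f w -> is_lead le f w.
Proof.
move=> fw; split=> [|v /(lead_msupp fw)[->|vw]].
- by rewrite -mcoeff_neq0 (lead_mcoeff fw) oner_eq0.
- by rewrite /word_le eqxx.
- by rewrite /word_le word_lt_wlen ?orbT.
Qed.

Lemma lead_uniq (le : rel Z) f v w : lead f w -> is_lead le f v -> v = w.
Proof.
move=> fw [vf vmax]; case: (lead_msupp fw vf) => // vw.
have /vmax/orP[/eqP/val_inj->//|/wlen_word_lt] : w \in msupp f.
  by rewrite -mcoeff_neq0 (lead_mcoeff fw) oner_eq0.
by rewrite leqNgt vw.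
Qed.

Lemma lead_inj f v w : lead f v -> lead f w -> v = w.
Proof.
(* An arbitrary relation on letters, to compare through [is_lead]. *)
move=> fv fw; apply: (lead_uniq (le := fun _ _ => true) fw).
exact: lead_is_lead.
Qed.

Lemma lead_monic (le : rel Z) f w : lead f w -> Defs.monic le f.
Proof.
by move=> fw; exists w; [exact: lead_is_lead|exact: lead_mcoeff].
Qed.

Lemma lead_linear (h : L -> L) f w w' : linear h -> lead f w ->
  h (fword w) = fword w' ->
  (forall v, (wlen v < wlen w)%N -> short (wlen w') (h (fword v))) ->
  lead (h f) w'.
Proof.
move=> lh fw hw hs; rewrite /lead -hw -linB //; exact: short_linear fw hs.
Qed.

End Leading.

(** * Normal s-words as an inductive family *)

Section NormalSwords.
Context (k : fieldType) (Z : choiceType).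
Local Notation L := (free_lalg k Z).
Implicit Types (u v w : nword Z) (f g h : L).

(** [nsw s sb w f]: f is the normal s-word with leading word w, for s of leading
    word sb. Building f one product at a time allows induction and case analysis
    on the position of s; normality of w is the side condition that the left
    factor of ≺ is not a ≻. [normal_sword_nsw] and [sword_nsw] compare it with
    substitution into a word with a star. *)
Inductive nsw (s : L) (sb : nword Z) : nword Z -> L -> Prop :=
| nsw_star : nsw s sb sb s
| nsw_succl w v f : nsw s sb w f -> nsw s sb (nsucc w v) (f ≻ fword v)
| nsw_succr w v f : nsw s sb v f -> nsw s sb (nsucc w v) (fword w ≻ f)
| nsw_precl w v f :
    ~~ is_succ w -> nsw s sb w f -> nsw s sb (nprec w v) (f ≺ fword v)
| nsw_precr w v f :
    ~~ is_succ w -> nsw s sb v f -> nsw s sb (nprec w v) (fword w ≺ f).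

Section Fixed.
Context (s : L) (sb : nword Z).

(** The products of L(Z) add lengths, so multiplying by a word preserves the gap
    between the leading word and the others. *)
Lemma nsw_lead w f : lead s sb -> nsw s sb w f -> lead f w.
Proof.
move=> ssb; elim=> {w f} [|w v f _ fw|w v f _ fv|w v f nw _ fw|w v f nw _ fv].
- exact: ssb.
- apply: (@lead_linear _ _ (fun f => f ≻ fword v) _ _ _
    (@lsucc_linearl _ _ _) fw).
    exact: fword_succ.
  move=> u uw; rewrite fword_succ.
  by apply: short_fword; rewrite !wlen_nsucc ltn_add2r.
- apply: (@lead_linear _ _ (fun f => fword w ≻ f) _ _ _
    (@lsucc_linearr _ _ _) fv).
    exact: fword_succ.
  move=> u uw; rewrite fword_succ.
  by apply: short_fword; rewrite !wlen_nsucc ltn_add2l.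
- apply: (@lead_linear _ _ (fun f => f ≺ fword v) _ _ _
    (@lprec_linearl _ _ _) fw).
    exact: fword_prec.
  move=> u uw; rewrite fword_prec.
  by apply: short_fword; rewrite !wlen_nprec ltn_add2r.
- apply: (@lead_linear _ _ (fun f => fword w ≺ f) _ _ _
    (@lprec_linearr _ _ _) fv).
    exact: fword_prec.
  move=> u uw; rewrite fword_prec.
  by apply: short_fword; rewrite !wlen_nprec ltn_add2l.
Qed.

(** The products of L(Z) compute the word itself exactly because that word is
    normal. *)
Lemma starfree_sword (u : word (option Z)) w :
  count_mem None (letters u) = 0%N -> wsubst u sb = w -> sword u s = fword w.
Proof.
elim: u w => [[z|]|[] a IHa b IHb] /= -[w nw] /=.
- by move=> _ wz; congr fword; apply: val_inj.
- by [].
- rewrite count_cat => /eqP; rewrite addn_eq0 => /andP[/eqP a0 /eqP b0] E.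
  subst w; case: (nword_Succ nw) => u [v [-> ua vb]].
  by rewrite (IHa u) // (IHb v) // fword_succ.
rewrite count_cat => /eqP; rewrite addn_eq0 => /andP[/eqP a0 /eqP b0] E.
subst w; case: (nword_Prec nw) => u [v [-> ua vb _]].
by rewrite (IHa u) // (IHb v) // fword_prec.
Qed.

Lemma nsw_sword (u : word (option Z)) w :
  star_word u -> wsubst u sb = w -> nsw s sb w (sword u s).
Proof.
rewrite /star_word; elim: u w => [[z|]|d a IHa b IHb] //= w.
  by move=> _ /val_inj <-; apply: nsw_star.
rewrite count_cat => ab.
have [[a1 b0]|[a0 b1]] : (count_mem None (letters a) == 1%N) /\
    count_mem None (letters b) = 0%N \/
  count_mem None (letters a) = 0%N /\ (count_mem None (letters b) == 1%N).
- case: (count_mem None (letters a)) ab => [|[|n]] //=; first by right.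
  by rewrite add1n eqSS => /eqP; left.
- case: w => w nw /= E; subst w; case: d nw => nw.
    case: (nword_Succ nw) => u [v [-> ua vb]].
    by rewrite (@starfree_sword b v) //; apply: nsw_succl; apply: IHa.
  case: (nword_Prec nw) => u [v [-> ua vb us]].
  by rewrite (@starfree_sword b v) //; apply: nsw_precl => //; apply: IHa.
case: w => w nw /= E; subst w; case: d nw => nw.
  case: (nword_Succ nw) => u [v [-> ua vb]].
  by rewrite (@starfree_sword a u) //; apply: nsw_succr; apply: IHb.
case: (nword_Prec nw) => u [v [-> ua vb us]].
by rewrite (@starfree_sword a u) //; apply: nsw_precr => //; apply: IHb.
Qed.

Fixpoint starless (w : word Z) : word (option Z) :=
  match w with
  | Letter z => Letter (Some z)
  | Node d u v => Node d (starless u) (starless v)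
  end.

Lemma starless_count (w : word Z) : count_mem None (letters (starless w)) = 0%N.
Proof. by elim: w => //= d u IHu v IHv; rewrite count_cat IHu IHv. Qed.

Lemma starless_wsubst (w x : word Z) : wsubst (starless w) x = w.
Proof. by elim: w => //= d u -> v ->. Qed.

Lemma starless_sword w : sword (starless w) s = fword w.
Proof. by apply: starfree_sword (starless_count _) (starless_wsubst _ _). Qed.

Lemma sword_nsw w f : nsw s sb w f ->
  exists u : word (option Z), [/\ star_word u, wsubst u sb = w & sword u s = f].
Proof.
elim=> {w f} => [|w v f _ [u [u1 uw us]]|w v f _ [u [u1 uv us]]
  |w v f nw _ [u [u1 uw us]]|w v f nw _ [u [u1 uv us]]].
- by exists (Letter None).
- exists (Node Succ u (starless v)); rewrite /= us starless_sword.
  rewrite uw starless_wsubst; split=> //.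
  by rewrite /star_word /= count_cat starless_count addn0.
- exists (Node Succ (starless w) u); rewrite /= us starless_sword.
  rewrite uv starless_wsubst; split=> //.
  by rewrite /star_word /= count_cat starless_count.
- exists (Node Prec u (starless v)); rewrite (nprecE _ nw) /= us starless_sword.
  rewrite uw starless_wsubst; split=> //.
  by rewrite /star_word /= count_cat starless_count addn0.
- exists (Node Prec (starless w) u); rewrite (nprecE _ nw) /= us starless_sword.
  rewrite uv starless_wsubst; split=> //.
  by rewrite /star_word /= count_cat starless_count.
Qed.

End Fixed.

Lemma normal_sword_nsw (le : rel Z) (s : L) sb (u : word (option Z)) w :
  lead s sb -> normal_sword le u s w -> nsw s sb w (sword u s).
Proof. by move=> ssb [u1 [v /(lead_uniq ssb)->]]; apply: nsw_sword. Qed.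

Definition prec_chain f (ws : seq (nword Z)) : L :=
  foldl lprec f (map fword ws).

Lemma prec_chain_rcons f ws v :
  prec_chain f (rcons ws v) = (prec_chain f ws ≺ fword v).
Proof. by rewrite /prec_chain map_rcons foldl_rcons. Qed.

Lemma prec_chain_cat f ws ws' :
  prec_chain f (ws ++ ws') = prec_chain (prec_chain f ws) ws'.
Proof. by rewrite /prec_chain map_cat foldl_cat. Qed.

Lemma prec_chain_fword w ws : prec_chain (fword w) ws = fword (nchain w ws).
Proof.
elim/last_ind: ws => [|ws v IH]; first exact: erefl.
rewrite prec_chain_rcons nchain_rcons IH; exact: fword_prec.
Qed.

Lemma prec_chain_linear ws : linear (prec_chain^~ ws).
Proof.
elim/last_ind: ws => [|ws v IH] a f g; first exact: erefl.
rewrite !prec_chain_rcons IH; exact: lprec_linearl.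
Qed.

(** The axiom (x ≻ y) ≺ z = x ≻ (y ≺ z), iterated. *)
Lemma lsucc_chain f g ws : prec_chain (f ≻ g) ws = (f ≻ prec_chain g ws).
Proof.
elim/last_ind: ws => [|ws v IH]; first exact: erefl.
rewrite !prec_chain_rcons IH; exact: lsucc_lprecA.
Qed.

Lemma nsw_chain s sb w f ws :
  ~~ is_succ w -> nsw s sb w f -> nsw s sb (nchain w ws) (prec_chain f ws).
Proof.
move=> nw fw; elim/last_ind: ws => [|ws v IH]; first exact: fw.
rewrite nchain_rcons prec_chain_rcons.
by apply: nsw_precl IH; apply: nchain_nsucc.
Qed.

Lemma nsw_nchain_mid s sb z ws1 v ws2 h : nsw s sb v h ->
  nsw s sb (nchain (nletter z) (ws1 ++ v :: ws2))
           (prec_chain (prec_chain (fletter z) ws1 ≺ h) ws2).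
Proof.
move=> vh; rewrite /nchain foldl_cat /= /fletter prec_chain_fword.
apply: nsw_chain; first by rewrite nprecE // nchain_nsucc.
by apply: nsw_precr vh; apply: nchain_nsucc.
Qed.

Lemma nsw_letter s sb z f : nsw s sb (nletter z) f -> sb = nletter z.
Proof.
move E: (nletter z) => w H.
case: H E => [E|u v h _|u v h _|u v h _ _|u v h _ _]; first exact: esym.
- by move/letter_neq_nsucc.
- by move/letter_neq_nsucc.
- by move/letter_neq_nprec.
- by move/letter_neq_nprec.
Qed.

Lemma nsw_nsucc s sb u1 u2 f : nsw s sb (nsucc u1 u2) f ->
  [\/ sb = nsucc u1 u2 /\ f = s,
      exists2 h, nsw s sb u1 h & f = (h ≻ fword u2) |
      exists2 h, nsw s sb u2 h & f = (fword u1 ≻ h)].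
Proof.
move E: (nsucc u1 u2) => w H.
case: H E => [E|u v h H|u v h H|u v h nu H|u v h nu H].
- by constructor 1.
- by case/nsucc_inj => -> ->; constructor 2; exists h.
- by case/nsucc_inj => -> ->; constructor 3; exists h.
- by move/nsucc_neq_nprec => /(_ nu).
- by move/nsucc_neq_nprec => /(_ nu).
Qed.

Lemma nsw_nprec s sb u1 u2 f : ~~ is_succ u1 -> nsw s sb (nprec u1 u2) f ->
  [\/ sb = nprec u1 u2 /\ f = s,
      exists2 h, nsw s sb u1 h & f = (h ≺ fword u2) |
      exists2 h, nsw s sb u2 h & f = (fword u1 ≺ h)].
Proof.
move=> n1; move E: (nprec u1 u2) => w H.
case: H E => [E|u v h H|u v h H|u v h nu H|u v h nu H].
- by constructor 1.
- by move/esym/nsucc_neq_nprec => /(_ n1).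
- by move/esym/nsucc_neq_nprec => /(_ n1).
- by case/(nprec_inj n1 nu) => -> ->; constructor 2; exists h.
- by case/(nprec_inj n1 nu) => -> ->; constructor 3; exists h.
Qed.

(** An occurrence of sb in z ≺ v_1 ≺ ... ≺ v_n is either a prefix of the chain
    or lies inside a single v_i. *)
Lemma nsw_nchain s sb z ws f : nsw s sb (nchain (nletter z) ws) f ->
  (exists ws1 ws2, ws = ws1 ++ ws2 /\ sb = nchain (nletter z) ws1) \/
  (exists ws1 v ws2 h, [/\ ws = ws1 ++ v :: ws2, nsw s sb v h &
     f = prec_chain (prec_chain (fletter z) ws1 ≺ h) ws2]).
Proof.
elim/last_ind: ws f => [|ws v IH] f.
  by move/nsw_letter => ->; left; exists [::], [::].
have nws : ~~ is_succ (nchain (nletter z) ws) by apply: nchain_nsucc.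
rewrite nchain_rcons => /nsw_nprec[//|[sbE _]|[h H ->]|[h H ->]].
- by left; exists (rcons ws v), [::]; rewrite cats0 nchain_rcons.
- have [[ws1 [ws2 [-> ->]]]|[ws1 [v' [ws2 [h' [-> H' ->]]]]]] := IH h H.
    by left; exists ws1, (rcons ws2 v); rewrite rcons_cat.
  right; exists ws1, v', (rcons ws2 v), h'.
  by rewrite prec_chain_rcons rcons_cat.
- right; exists ws, v, [::], h; rewrite cats1; split; [by []|exact: H|].
  by congr (_ ≺ h); apply/esym/prec_chain_fword.
Qed.

End NormalSwords.

(** * Sums of normal s-words *)

Section SwordSum.
Context (k : fieldType) (Z : choiceType) (le : rel Z).
Local Notation L := (free_lalg k Z).
Context (T : L -> Prop).
Implicit Types (B : nword Z -> Prop) (f g h : L).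

Lemma sword_sum0 B : sword_sum le T B 0.
Proof. by exists [::]; split=> //; rewrite big_nil. Qed.

Lemma sword_sumD B f g :
  sword_sum le T B f -> sword_sum le T B g -> sword_sum le T B (f + g).
Proof.
move=> [r [Tr ->]] [r' [Tr' ->]]; exists (r ++ r').
split; last by rewrite big_cat.
by move=> p; rewrite mem_cat => /orP[/Tr|/Tr'].
Qed.

Lemma sword_sumZ B a f : sword_sum le T B f -> sword_sum le T B (a *: f).
Proof.
move=> [r [Tr ->]]; exists [seq (a * p.1.1, p.1.2, p.2) | p <- r]; split.
  by move=> _ /mapP[p /Tr ? ->].
by rewrite big_map scaler_sumr; apply: eq_bigr => p _; rewrite scalerA.
Qed.

Lemma sword_sumB B f g :
  sword_sum le T B f -> sword_sum le T B g -> sword_sum le T B (f - g).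
Proof.
by move=> ? ?; rewrite -scaleN1r; apply: sword_sumD (sword_sumZ _ _).
Qed.

Lemma sword_sum_lincomb B (K : choiceType) (x : K -> L) (c : {malg k[K]}) :
  (forall i, i \in msupp c -> sword_sum le T B (x i)) ->
  sword_sum le T B (lincomb x c).
Proof.
move=> xT; rewrite /lincomb big_seq; elim/big_ind: _ => [||i /xT].
- exact: sword_sum0.
- exact: sword_sumD.
- exact: sword_sumZ.
Qed.

Lemma sword_sumW B B' f : (forall w, B w -> B' w) ->
  sword_sum le T B f -> sword_sum le T B' f.
Proof.
move=> BB' [r [Tr ->]]; exists r; split=> // p /Tr[Tp [w wp /BB' wB]].
by split=> //; exists w.
Qed.

Lemma sword_sum_nsw B s sb w f :
  T s -> lead s sb -> nsw s sb w f -> B w -> sword_sum le T B f.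
Proof.
move=> Ts ssb /sword_nsw[u [u1 uw <-]] Bw; exists [:: (1, u, s)]; split.
  move=> p; rewrite inE => /eqP-> /=; split=> //; exists w => //; split=> //.
  by exists sb => //; apply: lead_is_lead.
by rewrite big_seq1 scale1r.
Qed.

End SwordSum.
Arguments sword_sum_nsw {k Z le T B s sb w f}.

(** * Completing a coloured multiplication table *)

Section ColouredLetters.
Context (k : fieldType) (Z : choiceType) (C : eqType) (le : rel Z).
Context (colour : Z -> C) (tprec tsucc : Z -> Z -> {malg k[Z]}).
Local Notation L := (free_lalg k Z).
Implicit Types (a b c l : Z) (u v w : nword Z) (ws : seq (nword Z)) (f g h : L).

Hypothesis tprec_colour : forall a b l, colour a = colour b ->
  l \in msupp (tprec a b) -> colour l = colour a.
Hypothesis tsucc_colour : forall a b l, colour a = colour b ->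
  l \in msupp (tsucc a b) -> colour l = colour a.
(** The L-algebra axiom on letters of one colour, written in coordinates. *)
Hypothesis table_assoc : forall a b c, colour a = colour b ->
  colour b = colour c ->
  lincomb (fun l => tprec l c) (tsucc a b) = lincomb (tsucc a) (tprec b c).

Definition lcomb (d : {malg k[Z]}) : L := lincomb (fun l => fletter l) d.

Lemma lcomb_linear : linear lcomb.
Proof. exact: lincomb_linear. Qed.

Definition prel a b : L := (fletter a ≺ fletter b) - lcomb (tprec a b).

Definition srel a b ws : L :=
  (fletter a ≻ prec_chain (fletter b) ws) - prec_chain (lcomb (tsucc a b)) ws.

Definition prec_word a b : nword Z := nprec (nletter a) (nletter b).

Definition succ_word a b ws : nword Z :=
  nsucc (nletter a) (nchain (nletter b) ws).

Definition table f : Prop :=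
  exists a b, colour a = colour b /\ (f = prel a b \/ f = srel a b [::]).

(** The conditions on u, v_1, ..., v_n in F_1 and F_2. They hold vacuously for the
    empty list, so that the ≻-part of the table is covered by the same
    description. *)
Definition admissible b ws : Prop :=
  (forall v, v \in ws -> Irr le table v) /\
  (forall l, colour l = colour b -> ohead ws <> Some (nletter l)).

Definition completion f : Prop :=
  exists a b, colour a = colour b /\
    (f = prel a b \/ exists2 ws, admissible b ws & f = srel a b ws).

Lemma table_completion f : table f -> completion f.
Proof.
move=> [a [b [ab fE]]]; exists a, b; split; first exact: ab.
by case: fE => ->; [left|right; exists [::]].
Qed.

Lemma prec_chain_lcomb d ws :
  prec_chain (lcomb d) ws = lincomb (fun l => fword (nchain (nletter l) ws)) d.
Proof.
rewrite (lin_lincomb (@prec_chain_linear k Z ws)).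
by apply: eq_lincomb => l _; apply: prec_chain_fword.
Qed.

Lemma lead_opp w f : short (wlen w) f -> lead (fword w - f) w.
Proof. by rewrite /lead /short addrAC subrr add0r msuppN. Qed.

Lemma prel_lead a b : lead (prel a b) (prec_word a b).
Proof.
rewrite /prel /fletter fword_prec; apply: lead_opp; apply: short_lincomb => l _.
exact: short_fword.
Qed.

Lemma wlen_succ_word a b ws :
  wlen (succ_word a b ws) = (wlen (nchain (nletter b) ws)).+1.
Proof. by rewrite wlen_nsucc. Qed.

Lemma wlen_nchain_letter a b ws :
  wlen (nchain (nletter a) ws) = wlen (nchain (nletter b) ws).
Proof. by rewrite !wlen_nchain. Qed.

Lemma nchain_lt_succ_word a b l ws :
  (wlen (nchain (nletter l) ws) < wlen (succ_word a b ws))%N.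
Proof. by rewrite wlen_succ_word (wlen_nchain_letter l b). Qed.

Lemma srel_lead a b ws : lead (srel a b ws) (succ_word a b ws).
Proof.
rewrite /srel /fletter prec_chain_fword fword_succ; apply: lead_opp.
rewrite prec_chain_lcomb; apply: short_lincomb => l _; apply: short_fword.
exact: nchain_lt_succ_word.
Qed.

Lemma completion_lead f : completion f -> exists w, lead f w.
Proof.
move=> [a [b [_ [->|[ws _ ->]]]]].
  by exists (prec_word a b); apply: prel_lead.
by exists (succ_word a b ws); apply: srel_lead.
Qed.

(** The leading word determines the pair of letters and the list, hence the
    relation: a composition of inclusion at the root is zero. *)
Lemma completion_inj f g w : completion f -> completion g ->
  lead f w -> lead g w -> f = g.
Proof.
move=> [a [b [_ [->|[ws _ ->]]]]] [a' [b' [_ [->|[ws' _ ->]]]]] fw gw.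
- have := lead_inj (prel_lead a b) fw; rewrite -(lead_inj (prel_lead a' b') gw).
  by case/(@nprec_inj _ (nletter a) _ (nletter a') _ isT isT) => -[->] [->].
- have := lead_inj (prel_lead a b) fw.
  rewrite -(lead_inj (srel_lead a' b' ws') gw).
  by move=> /esym/nsucc_neq_nprec[].
- have := lead_inj (srel_lead a b ws) fw.
  rewrite -(lead_inj (prel_lead a' b') gw).
  by move=> /nsucc_neq_nprec[].
have := lead_inj (srel_lead a b ws) fw.
rewrite -(lead_inj (srel_lead a' b' ws') gw).
by move=> /nsucc_inj[[->]] /nchain_letter_inj[-> ->].
Qed.

(** So a composition of right multiplication is srel of a longer list, no longer
    admissible in general. *)
Lemma srel_prec a b ws v : (srel a b ws ≺ fword v) = srel a b (rcons ws v).
Proof.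
rewrite /srel !prec_chain_rcons -lsucc_lprecA.
exact: (linB (f := fun f : L => f ≺ fword v) (@lprec_linearl _ _ _)).
Qed.

Definition shorter n w : Prop := (wlen (w : nword Z) < n)%N.

(** With h = v + (shorter words), linearity in the slot of v rewrites srel at v
    as srel at h minus the srel at shorter words. Of the two terms of srel at h,
    the first is the one subtracted here, and the second has leading words
    shorter by one letter, since {a ≻ b} is a combination of letters. *)
Lemma srel_replace a b ws1 v ws2 g gb h :
  completion g -> lead g gb -> nsw g gb v h ->
  (forall v', (wlen v' < wlen v)%N -> sword_sum le completion
     (shorter (wlen (succ_word a b (ws1 ++ v :: ws2))))
     (srel a b (ws1 ++ v' :: ws2))) ->
  sword_sum le completion (shorter (wlen (succ_word a b (ws1 ++ v :: ws2))))
    (srel a b (ws1 ++ v :: ws2)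
     - (fletter a ≻ prec_chain (prec_chain (fletter b) ws1 ≺ h) ws2)).
Proof.
move=> Gg ggb gv IH.
pose ctx f h := prec_chain (prec_chain f ws1 ≺ h) ws2.
have ctxl h' : linear (ctx ^~ h').
  move=> x f f'; rewrite /ctx prec_chain_linear lprec_linearl.
  exact: prec_chain_linear.
have ctxr f : linear (ctx f).
  by move=> x h1 h2; rewrite /ctx lprec_linearr; apply: prec_chain_linear.
pose phi h' := (fletter a ≻ ctx (fletter b) h') - ctx (lcomb (tsucc a b)) h'.
have phil : linear phi.
  move=> x h1 h2; rewrite /phi !ctxr lsucc_linearr scalerBr.
  by rewrite opprD addrACA.
have phiE v' : srel a b (ws1 ++ v' :: ws2) = phi (fword v').
  by rewrite /srel !prec_chain_cat.
have -> : srel a b (ws1 ++ v :: ws2) - (fletter a ≻ ctx (fletter b) h) =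
    - ctx (lcomb (tsucc a b)) h - phi (h - fword v).
  have -> : srel a b (ws1 ++ v :: ws2) = phi h - phi (h - fword v).
    rewrite phiE; apply: etrans (linB phil h (h - fword v)).
    by congr phi; rewrite subKr.
  have alg (V : zmodType) (p q r : V) : p - q - r - p = - q - r.
    by rewrite addrAC [p - q]addrC addrK.
  exact: alg.
apply: sword_sumB.
  rewrite -scaleN1r; apply: sword_sumZ.
  rewrite (lin_lincomb (ctxl h)); apply: sword_sum_lincomb => l _.
  rewrite [(_ \o _) l]/=.
  apply: (sword_sum_nsw (le := le) (w := nchain (nletter l) (ws1 ++ v :: ws2))
    Gg ggb).
    exact: nsw_nchain_mid gv.
  exact: nchain_lt_succ_word.
rewrite -[h - _]lincomb_id (lin_lincomb phil); apply: sword_sum_lincomb => v'.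
rewrite [(_ \o _) v']/=.
by move=> /(shortP _ _ (nsw_lead ggb gv)) /IH; rewrite phiE.
Qed.

Lemma wlen_succ_word_cat a b ws1 v ws2 v' : (wlen v' < wlen v)%N ->
  (wlen (succ_word a b (ws1 ++ v' :: ws2))
   < wlen (succ_word a b (ws1 ++ v :: ws2)))%N.
Proof.
move=> vv; rewrite !wlen_succ_word ltnS !wlen_nchain !map_cat !sumn_cat /=.
by rewrite !ltn_add2l ltn_add2r.
Qed.

(** Rewriting both letters next to c leaves a combination of srel a l ws and
    normal s-words that are shorter by one letter; the remaining terms on the two
    sides agree by [table_assoc]. *)
Lemma srel_letter a b c ws : colour a = colour b -> colour b = colour c ->
  (forall l, colour l = colour a -> sword_sum le completion
     (shorter (wlen (succ_word a b (nletter c :: ws)))) (srel a l ws)) ->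
  sword_sum le completion (shorter (wlen (succ_word a b (nletter c :: ws))))
    (srel a b (nletter c :: ws) - (fletter a ≻ prec_chain (prel b c) ws)).
Proof.
move=> ab bc IH.
pose f0 := fletter c : L; pose da := fletter a : L.
have chl := @prec_chain_linear k Z ws.
have sl : linear (fun f : L => da ≻ f) := @lsucc_linearr k _ da.
have pl : linear (fun f : L => f ≺ f0) := @lprec_linearl k _ f0.
pose p := da ≻ prec_chain (fletter b ≺ f0) ws.
pose q := prec_chain (lcomb (tsucc a b) ≺ f0) ws.
pose r := da ≻ prec_chain (lcomb (tprec b c)) ws.
pose t := prec_chain (lcomb (lincomb (tsucc a) (tprec b c))) ws.
have E1 : (da ≻ prec_chain (prel b c) ws) = p - r.
  by rewrite /prel (linB chl); apply: (linB sl).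
have E2 : lincomb (fun l => srel a l ws) (tprec b c) = r - t.
  apply: etrans (esym (lincombB _ _ _)) _; congr (_ - _).
    by apply: esym; apply: (lin_lincomb (linear_comp sl chl)).
  by apply: esym; apply: (lin_lincomb (linear_comp chl lcomb_linear)).
have E3 : lincomb (fun l => prec_chain (prel l c) ws) (tsucc a b) = q - t.
  transitivity (lincomb (fun l => prec_chain (fletter l ≺ f0) ws
      - prec_chain (lcomb (tprec l c)) ws) (tsucc a b)).
    by apply: eq_lincomb => l _; apply: (linB chl).
  apply: etrans (esym (lincombB _ _ _)) _; congr (_ - _).
    by apply: esym; apply: (lin_lincomb (linear_comp chl pl)).
  rewrite /t -table_assoc //.
  by apply: esym; apply: (lin_lincomb (linear_comp chl lcomb_linear)).
have -> : srel a b (nletter c :: ws) - (da ≻ prec_chain (prel b c) ws) =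
    lincomb (fun l => srel a l ws) (tprec b c)
    - lincomb (fun l => prec_chain (prel l c) ws) (tsucc a b).
  have alg (V : zmodType) (x y z w : V) : x - y - (x - z) = z - w - (y - w).
    by rewrite !opprB [LHS]addrC !addrA !subrK.
  rewrite E1 E2 E3; exact: alg.
have cp l : colour l = colour c -> completion (prel l c).
  by move=> lc; exists l, c; split; [exact: lc|left].
apply: sword_sumB.
  apply: sword_sum_lincomb => l lt; apply: IH.
  by rewrite (tprec_colour bc lt).
apply: sword_sum_lincomb => l lt.
have lc : colour l = colour c by rewrite (tsucc_colour ab lt) ab.
apply: (sword_sum_nsw (le := le) (w := nchain (nletter l) (nletter c :: ws))
  (cp l lc) (prel_lead l c)).
  exact: (@nsw_chain _ _ _ _ (prec_word l c) _ ws isT (nsw_star _ _)).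
exact: nchain_lt_succ_word.
Qed.

(** The bound is attained, by srel itself or by the s-word that comes from its
    first term; hence the disjunction rather than a comparison in the word order. *)
Lemma srel_trivial a b ws : colour a = colour b ->
  sword_sum le completion
    (fun w => w = succ_word a b ws \/ shorter (wlen (succ_word a b ws)) w)
    (srel a b ws).
Proof.
have [n] := ubnP (wlen (succ_word a b ws)); elim: n => // n IH in a b ws *.
rewrite ltnS => wn ab.
have {}IH a' b' ws' :
    (wlen (succ_word a' b' ws') < wlen (succ_word a b ws))%N ->
    colour a' = colour b' ->
    sword_sum le completion (shorter (wlen (succ_word a b ws)))
      (srel a' b' ws').
  move=> lt ab'; apply: sword_sumW (IH _ _ _ (leq_trans lt wn) ab').
  by move=> w [->|wlt]; [exact: lt|exact: ltn_trans wlt lt].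
pose B w := w = succ_word a b ws \/ shorter (wlen (succ_word a b ws)) w.
have small f : sword_sum le completion (shorter (wlen (succ_word a b ws))) f ->
    sword_sum le completion B f.
  by apply: sword_sumW => w; right.
have [adm|/not_andP[]] := EM (admissible b ws).
- apply: (sword_sum_nsw (le := le) (w := succ_word a b ws) (s := srel a b ws)).
  + by exists a, b; split; [exact: ab|right; exists ws].
  + exact: srel_lead.
  + exact: nsw_star.
  + by left.
(* Some entry v of the list is reducible. *)
- move=> /existsNP[v /not_implyP[vws]].
  have [ws1 [ws2 wsE]] : exists ws1 ws2, ws = ws1 ++ v :: ws2.
    by case/splitPr: vws => ws1 ws2; exists ws1, ws2.
  subst ws.
  move=> /existsNP[u /existsNP[s /not_implyP[ts /contrapT us]]].
  have cs := table_completion ts.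
  have [sb ssb] := completion_lead cs.
  have sv := normal_sword_nsw ssb us.
  rewrite -[srel _ _ _](subrK (fletter a ≻
    prec_chain (prec_chain (fletter b) ws1 ≺ sword u s) ws2)).
  apply: sword_sumD.
    apply: small; apply: srel_replace cs ssb sv _ => v' lt.
    by apply: IH => //; apply: wlen_succ_word_cat.
  apply: (sword_sum_nsw (le := le) (w := succ_word a b (ws1 ++ v :: ws2))
    cs ssb); last by left.
  by apply: nsw_succr; apply: nsw_nchain_mid.
(* The head of the list is a letter c of the colour of b. *)
move=> /existsNP[c /not_implyP[cb /contrapT]].
move=> hdE; have [ws' wsE] : exists ws', ws = nletter c :: ws'.
  by case: (ws) hdE => // u ws' [->]; exists ws'.
subst ws; rename ws' into ws.
rewrite -[srel _ _ _](subrK (fletter a ≻ prec_chain (prel b c) ws)).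
have cp : completion (prel b c) by exists b, c; split; [exact: esym|left].
apply: sword_sumD.
  apply: small; apply: srel_letter => // l la; apply: IH => //.
  by rewrite !wlen_succ_word ltnS !wlen_nchain /= ltn_add2l.
apply: (sword_sum_nsw (le := le) (w := succ_word a b (nletter c :: ws))
  cp (prel_lead b c)).
  apply: nsw_succr.
  exact: (@nsw_chain _ _ _ _ (prec_word b c) _ ws isT (nsw_star _ _)).
by left.
Qed.

(** No relation has a leading word that is a prefix b ≺ w_1 ≺ ... of an admissible
    chain: such a leading word would be b ≺ c with c a letter of the colour of b.
    For the empty prefix this says that no leading word is a letter. *)
Lemma admissible_split b ws1 ws2 g gb : admissible b (ws1 ++ ws2) ->
  completion g -> lead g gb -> gb <> nchain (nletter b) ws1.
Proof.
move=> [_ hd] cg ggb E.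
case: cg ggb => a' [b' [ab' [->|[ws' _ ->]]]] ggb.
- have := lead_inj ggb (prel_lead a' b'); rewrite E.
  move=> /(@nchain_letter_inj _ b a' ws1 [:: nletter b'])[ba ws1E].
  by apply: (hd b'); rewrite ?ws1E // ba.
- have := lead_inj ggb (srel_lead a' b' ws').
  rewrite E => /(congr1 (@nword_val Z)).
  by move: (@nchain_nsucc _ (nletter b) ws1 isT) => + E'; rewrite E'.
Qed.

Lemma completion_GS : GS_basis le completion.
Proof.
split.
- by move=> f /completion_lead[w /(lead_monic le)].
- move=> f u1 u2 v [a [b [ab [->|[ws _ ->]]]]].
    by move=> /(lead_uniq (prel_lead a b))/nsucc_neq_nprec[].
  move=> _; rewrite srel_prec; apply: sword_sumW (srel_trivial _ ab) => w wB.
  exists (succ_word a b (rcons ws v)); first exact/lead_is_lead/srel_lead.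
  rewrite /word_le.
  by case: wB => [->|/(word_lt_wlen le)->]; rewrite ?eqxx ?orbT.
move=> f g u w cf cg fw ug.
have [gb ggb] := completion_lead cg.
have gw := normal_sword_nsw ggb ug.
have [fb ffb] := completion_lead cf.
have E := lead_uniq ffb fw; subst fb.
have gletter z : gb <> nletter z.
  exact: (@admissible_split z [::] [::] g gb _ cg ggb).
case: (cf) => a [b [ab fE]].
suff : sword_sum le completion (shorter (wlen w)) (f - sword u g).
  by apply: sword_sumW => w' /(word_lt_wlen le).
case: fE => [fE|[ws adm fE]].
  have wE : w = prec_word a b.
    by apply: (lead_inj ffb); rewrite fE; apply: prel_lead.
  move: gw; rewrite wE => /nsw_nprec[//|[gE ->]|[h /nsw_letter/gletter//]|].
    have gw : lead g w by rewrite wE; rewrite gE in ggb; exact: ggb.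
    rewrite (completion_inj cf cg ffb gw) subrr; exact: sword_sum0.
  by case=> h /nsw_letter/gletter.
have wE : w = succ_word a b ws.
  by apply: (lead_inj ffb); rewrite fE; apply: srel_lead.
move: gw; rewrite wE => /nsw_nsucc[[gE ->]|[h /nsw_letter/gletter//]|].
  have gw : lead g w by rewrite wE; rewrite gE in ggb; exact: ggb.
    rewrite (completion_inj cf cg ffb gw) subrr; exact: sword_sum0.
case=> h /nsw_nchain[[ws1 [ws2 [wsE gbE]]]|[ws1 [v [ws2 [h' [wsE gv hE]]]]]] ->.
  by rewrite wsE in adm; case: (admissible_split adm cg ggb gbE).
rewrite fE hE wsE; apply: srel_replace cg ggb gv _ => v' lt.
apply: sword_sumW (srel_trivial _ ab) => w'.
have lt' := wlen_succ_word_cat a b ws1 ws2 lt.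
by case=> [->|wlt]; [exact: lt'|exact: ltn_trans wlt lt'].
Qed.

Lemma srel_chain a b ws : srel a b ws = prec_chain (srel a b [::]) ws.
Proof.
rewrite /srel -lsucc_chain; apply: esym.
exact: (linB (@prec_chain_linear k Z ws)).
Qed.

Lemma Id_completion f : Id completion f <-> Id table f.
Proof.
split=> H D DI TD; apply: H => // {}f; last by move/table_completion/TD.
move=> [a [b [ab [->|[ws _ ->]]]]].
  by apply: TD; exists a, b; split; [|left].
rewrite srel_chain; elim/last_ind: ws => [|ws v IH].
  by apply: TD; exists a, b; split; [|right].
by rewrite prec_chain_rcons; case: DI => _ _ /(_ _ (fword v) IH)[].
Qed.

End ColouredLetters.

(** * Coordinates in a basis *)

Section Coordinates.
Context (k : fieldType) (V : lmodType k) (I : choiceType) (x : I -> V).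
Hypothesis xB : is_basis x.

Lemma basis_span v : exists c, lincomb x c = v.
Proof. by case: (xB v) => c [cv _]; exists c. Qed.

Definition coord v : {malg k[I]} := sval (cid (basis_span v)).

Lemma coordK v : lincomb x (coord v) = v.
Proof. exact: (svalP (cid (basis_span v))). Qed.

Lemma lincombK c : coord (lincomb x c) = c.
Proof.
case: (xB (lincomb x c)) => d [_ dU].
exact: etrans (esym (dU _ (coordK _))) (dU c erefl).
Qed.

Lemma coord_linear : linear coord.
Proof.
move=> a u v; rewrite -[u in LHS]coordK -[v in LHS]coordK.
by rewrite -lincomb_linear lincombK.
Qed.

Lemma coord_basis i : coord (x i) = << i >>.
Proof. by rewrite -[x i]lincombU lincombK. Qed.

Lemma basis_ext (W : lmodType k) (f g : V -> W) :
  linear f -> linear g -> (forall i, f (x i) = g (x i)) -> f =1 g.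
Proof.
move=> lf lg fg v; rewrite -[v]coordK (lin_lincomb lf) (lin_lincomb lg).
by apply: eq_lincomb => i _; apply: fg.
Qed.

End Coordinates.

(** * Universal properties of L(Z) and of its quotients *)

Section FreeHom.
Context (k : fieldType) (Z : choiceType) (A : lalgebraType k) (phi : Z -> A).
Local Notation L := (free_lalg k Z).

Fixpoint weval (w : word Z) : A :=
  match w with
  | Letter z => phi z
  | Node Succ u v => weval u ≻ weval v
  | Node Prec u v => weval u ≺ weval v
  end.

(** The recursion that defines [bracket] is the L-algebra axiom read from left to
    right. *)
Lemma weval_bracket (u v : word Z) :
  weval (bracket u v) = (weval u ≺ weval v).
Proof.
elim: u => [z|[] u1 _ u2 IH] /=; [exact: erefl| |exact: erefl].
by rewrite IH lsucc_lprecA.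
Qed.

Definition feval (f : L) : A := lincomb (fun w : nword Z => weval w) f.

Lemma feval_linear : linear feval.
Proof. exact: lincomb_linear. Qed.

Lemma feval_fword w : feval (fword w) = weval w.
Proof. exact: lincombU. Qed.

Lemma feval_letter z : feval (fletter z) = phi z.
Proof. exact: feval_fword. Qed.

(** Compatibility with a bilinear operation has to be checked on words only. *)
Lemma feval_bilin (op : L -> L -> L) (opA : A -> A -> A) :
  (forall g, linear (op^~ g)) -> (forall f, linear (op f)) ->
  (forall b, linear (opA^~ b)) -> (forall a, linear (opA a)) ->
  (forall u v, feval (op (fword u) (fword v))
               = opA (feval (fword u)) (feval (fword v))) ->
  {morph feval : f g / op f g >-> opA f g}.
Proof.
move=> opl opr opAl opAr E f g.
apply: (linear_ext (f := fun f => feval (op f g))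
                   (g := fun f => opA (feval f) (feval g))) => [||u].
- exact: (@linear_comp _ _ _ feval feval_linear _ (op^~ g) (opl g)).
- exact: (@linear_comp _ _ _ (opA^~ (feval g)) (opAl _) _ feval feval_linear).
apply: (linear_ext (f := fun g => feval (op (fword u) g))
                   (g := fun g => opA (feval (fword u)) (feval g))) => [||v].
- exact: (@linear_comp _ _ _ feval feval_linear _ (op (fword u)) (opr _)).
- exact: (@linear_comp _ _ _ (opA (feval (fword u))) (opAr _) _
    feval feval_linear).
exact: E.
Qed.

Lemma feval_hom : is_lalg_hom feval.
Proof.
split; first exact: feval_linear.
- apply: feval_bilin => [g|f|b|a|u v].
  + exact: lprec_linearl.
  + exact: lprec_linearr.
  + exact: lprec_linearl.
  + exact: lprec_linearr.
  apply: etrans (congr1 feval (fword_prec k u v)) _.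
  apply: etrans (feval_fword _) _; apply: etrans (weval_bracket u v) _.
  by congr (_ ≺ _); apply/esym/feval_fword.
apply: feval_bilin => [g|f|b|a|u v].
+ exact: lsucc_linearl.
+ exact: lsucc_linearr.
+ exact: lsucc_linearl.
+ exact: lsucc_linearr.
apply: etrans (congr1 feval (fword_succ k u v)) _.
apply: etrans (feval_fword _) _.
by congr (_ ≻ _); apply/esym/feval_fword.
Qed.

Lemma free_hom_uniq (h : L -> A) :
  is_lalg_hom h -> (forall z, h (fletter z) = phi z) -> h =1 feval.
Proof.
move=> [hl hp hs] hz.
apply: linear_ext => [||w]; [exact: hl|exact: feval_linear|].
apply: etrans _ (esym (feval_fword w)).
case: w => w nw; elim: w nw => [z|[] u IHu v IHv] nw.
- by rewrite (_ : NWord nw = nletter z); [exact: hz|exact: val_inj].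
- have [nu [nv [-> uE vE]]] := nword_Succ nw.
  apply: etrans (congr1 h (esym (fword_succ k nu nv))) _; rewrite hs /=.
  case: nu nv uE vE => u' nu' [v' nv'] /= uE vE; subst u' v'.
  by congr (_ ≻ _); [exact: IHu|exact: IHv].
have [nu [nv [-> uE vE _]]] := nword_Prec nw.
apply: etrans (congr1 h (esym (fword_prec k nu nv))) _.
rewrite hp /= weval_bracket.
case: nu nv uE vE => u' nu' [v' nv'] /= uE vE; subst u' v'.
by congr (_ ≺ _); [exact: IHu|exact: IHv].
Qed.

End FreeHom.

Section QuotientHom.
Context (k : fieldType) (A B : lalgebraType k) (T : A -> Prop) (g : A -> B).
Hypothesis gH : is_lalg_hom g.
Hypothesis gT : forall t, T t -> g t = 0.

(** The kernel is an ideal containing T, so it contains Id T; this is what makes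
    [qlift] independent of representatives. *)
Lemma ker_ideal : is_ideal (fun f => g f = 0).
Proof.
case: gH => gl gp gs; split=> [|a f f' f0 f'0|f f' f0].
- exact: lin0 gl.
- by rewrite gl f0 f'0 scaler0 addr0.
rewrite !gp !gs f0; split.
- exact: lin0 (@lprec_linearl _ _ _).
- exact: lin0 (@lprec_linearr _ _ _).
- exact: lin0 (@lsucc_linearl _ _ _).
- exact: lin0 (@lsucc_linearr _ _ _).
Qed.

Definition qlift (q : lquot T) : B := g (repr q).

Lemma lquot_pi_repr (q : lquot T) : lquot_pi T (repr q) = q.
Proof. exact: reprK. Qed.

Lemma qliftE f : qlift (lquot_pi T f) = g f.
Proof.
have /lquot_piP If : lquot_pi T (repr (lquot_pi T f)) = lquot_pi T f.
  exact: lquot_pi_repr.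
apply/eqP; rewrite -subr_eq0 /qlift; case: (gH) => gl _ _.
by apply/eqP; apply: etrans (esym (linB gl _ _)) _; apply: (If _ ker_ideal gT).
Qed.

Lemma qlift_hom : is_lalg_hom qlift.
Proof.
case: (gH) (lquot_pi_hom T) => gl gp gs [pl pp ps].
split=> [a p q|p q|p q]; rewrite -[p]lquot_pi_repr -[q]lquot_pi_repr.
- by rewrite -pl !qliftE gl.
- by rewrite -pp !qliftE gp.
- by rewrite -ps !qliftE gs.
Qed.

End QuotientHom.

Lemma hom_comp (k : fieldType) (A B C : lalgebraType k)
    (g : B -> C) (f : A -> B) :
  is_lalg_hom g -> is_lalg_hom f -> is_lalg_hom (g \o f).
Proof.
move=> [gl gp gs] [fl fp fs]; split=> [|u v|u v] /=.
- exact: linear_comp.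
- by rewrite fp gp.
- by rewrite fs gs.
Qed.

(** * The coproduct of two L-algebras *)

Section Factor.
Context (k : fieldType) (A : lalgebraType k) (I Z : choiceType).
Context (x : I -> A) (e : I -> Z).
Hypothesis xB : is_basis x.
Local Notation L := (free_lalg k Z).

Section Inject.
Context (T : L -> Prop).
Hypothesis xT : forall f, table_rel x e f -> T f.

Definition inject (a : A) : lquot T :=
  lquot_pi T (lincomb (fun l => fletter (e l)) (coord xB a)).

Lemma inject_basis i : inject (x i) = lquot_pi T (fletter (e i)).
Proof. by rewrite /inject coord_basis lincombU. Qed.

Lemma inject_linear : linear inject.
Proof.
apply: (linear_comp (@lquot_pi_linear k L T)).
apply: (linear_comp _ (coord_linear xB)); exact: lincomb_linear.
Qed.

(** By bilinearity it suffices to multiply two basis vectors, and this is what the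
    relations of the table state. *)
Lemma inject_bilin (op : A -> A -> A) (opL : L -> L -> L)
    (opQ : lquot T -> lquot T -> lquot T) :
  (forall b, linear (op^~ b)) -> (forall a, linear (op a)) ->
  (forall b, linear (opQ^~ b)) -> (forall a, linear (opQ a)) ->
  {morph lquot_pi T : f g / opL f g >-> opQ f g} ->
  (forall i j c, lincomb x c = op (x i) (x j) ->
     T (opL (fletter (e i)) (fletter (e j))
        - lincomb (fun l => fletter (e l)) c)) ->
  {morph inject : a b / op a b >-> opQ a b}.
Proof.
move=> opl opr opQl opQr piM opT a b.
apply: (basis_ext xB (f := fun a => inject (op a b))
                  (g := fun a => opQ (inject a) (inject b))) => [||i].
- exact: (@linear_comp _ _ _ inject inject_linear _ (op^~ b) (opl b)).
- exact: (@linear_comp _ _ _ (opQ^~ (inject b)) (opQl _) _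
    inject inject_linear).
apply: (basis_ext xB (f := fun b => inject (op (x i) b))
                  (g := fun b => opQ (inject (x i)) (inject b))) => [||j].
- exact: (@linear_comp _ _ _ inject inject_linear _ (op (x i)) (opr _)).
- exact: (@linear_comp _ _ _ (opQ (inject (x i))) (opQr _) _
    inject inject_linear).
rewrite !inject_basis -piM; apply: esym; apply/lquot_piP => D _; apply.
by apply: opT; apply: coordK.
Qed.

Lemma inject_hom : is_lalg_hom inject.
Proof.
have [_ pp ps] := lquot_pi_hom T; split; first exact: inject_linear.
- apply: (inject_bilin _ _ _ _ pp) => [b|a|b|a|i j c E].
  + exact: lprec_linearl.
  + exact: lprec_linearr.
  + exact: lprec_linearl.
  + exact: lprec_linearr.
  by apply: xT; exists i, j, c; left.
apply: (inject_bilin _ _ _ _ ps) => [b|a|b|a|i j c E].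
+ exact: lsucc_linearl.
+ exact: lsucc_linearr.
+ exact: lsucc_linearl.
+ exact: lsucc_linearr.
by apply: xT; exists i, j, c; right.
Qed.

End Inject.

Lemma feval_table (B : lalgebraType k) (f : A -> B) (phi : Z -> B) t :
  is_lalg_hom f -> (forall i, phi (e i) = f (x i)) ->
  table_rel x e t -> feval phi t = 0.
Proof.
move=> [fl fp fs] fphi.
have evL c : feval phi (lincomb (fun l => fletter (e l)) c) = f (lincomb x c).
  rewrite (lin_lincomb (feval_linear phi)) (lin_lincomb fl).
  apply: eq_lincomb => i _; exact: etrans (feval_letter phi (e i)) (fphi i).
have [evl evp evs] := feval_hom phi.
have evX i : feval phi (fletter (e i)) = f (x i).
  exact: etrans (feval_letter phi (e i)) (fphi i).
have evB u c a : lincomb x c = a -> feval phi u = f a ->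
    feval phi (u - lincomb (fun l => fletter (e l)) c) = 0.
  move=> ca uf; apply: etrans (linB evl _ _) _.
  by rewrite evL ca uf subrr.
move=> [i [j [c [[E ->]|[E ->]]]]]; apply: (evB _ _ _ E).
  apply: etrans (evp _ _) _; apply: etrans _ (esym (fp _ _)).
  by congr (_ ≺ _); apply: evX.
apply: etrans (evs _ _) _; apply: etrans _ (esym (fs _ _)).
by congr (_ ≻ _); apply: evX.
Qed.

End Factor.

Section Presentation.
Context (k : fieldType) (L1 L2 : lalgebraType k) (I J : choiceType).
Context (x : I -> L1) (y : J -> L2).
Hypotheses (xB : is_basis x) (yB : is_basis y).

Lemma S_12_presents : presents_free_product x y.
Proof.
pose T := S_12 x y.
have xT f : table_rel x inl f -> T f by left.
have yT f : table_rel y inr f -> T f by right.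
exists (inject inl xB T), (inject inr yB T); split=> [i|j|].
- exact: inject_basis.
- exact: inject_basis.
split; [exact: inject_hom|exact: inject_hom|move=> A f g fH gH].
pose phi (z : I + J) : A :=
  match z with inl i => f (x i) | inr j => g (y j) end.
have phiT t : T t -> feval phi t = 0.
  by case; [apply: feval_table fH _|apply: feval_table gH _].
have evH := feval_hom phi.
have qH := qlift_hom evH phiT.
have [iH1 iH2] := (inject_hom xB xT, inject_hom yB yT).
exists (qlift (T := T) (feval phi)); split=> [|||h hH hx hy].
- exact: qH.
- apply: (basis_ext xB) => [||i]; [by case: (hom_comp qH iH1)|by case: fH|].
  by rewrite /= inject_basis (qliftE evH phiT); apply: feval_letter.
- apply: (basis_ext yB) => [||j]; [by case: (hom_comp qH iH2)|by case: gH|].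
  by rewrite /= inject_basis (qliftE evH phiT); apply: feval_letter.
move=> q; rewrite -[q]lquot_pi_repr (qliftE evH phiT).
apply: (free_hom_uniq (phi := phi) (hom_comp hH (lquot_pi_hom T))) => -[i|j] /=.
  by rewrite -(inject_basis inl xB); apply: hx.
by rewrite -(inject_basis inr yB); apply: hy.
Qed.

End Presentation.

(** * The two factors as a coloured table *)

Section TransportedRelations.
Context (k : fieldType) (A : lalgebraType k) (I Z : choiceType).
Context (x : I -> A) (e : I -> Z).
Hypothesis xB : is_basis x.
Local Notation L := (free_lalg k Z).

Definition push (c : {malg k[I]}) : {malg k[Z]} :=
  lincomb (fun i => << e i >>) c.

Lemma push_linear : linear push.
Proof. exact: lincomb_linear. Qed.

Lemma lincomb_push (V : lmodType k) (F : Z -> V) c :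
  lincomb F (push c) = lincomb (fun i => F (e i)) c.
Proof.
rewrite /push lincomb_lincomb; apply: eq_lincomb => i _; exact: lincombU.
Qed.

(** Moves a linear operation of the algebra across the transport of coordinates;
    this is how the axiom in A becomes [table_assoc]. *)
Lemma push_coord (h : A -> A) a : linear h ->
  lincomb (fun i => push (coord xB (h (x i)))) (coord xB a)
  = push (coord xB (h a)).
Proof.
move=> lh; rewrite -{2}(coordK xB a) (lin_lincomb lh).
by rewrite (lin_lincomb (coord_linear xB)) (lin_lincomb push_linear).
Qed.

Context (tprec tsucc : Z -> Z -> {malg k[Z]}).
Hypothesis tprecE : forall i j,
  tprec (e i) (e j) = push (coord xB (x i ≺ x j)).
Hypothesis tsuccE : forall i j,
  tsucc (e i) (e j) = push (coord xB (x i ≻ x j)).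

Lemma prel_push i j c : lincomb x c = (x i ≺ x j) ->
  prel tprec (e i) (e j) =
  (fletter (e i) ≺ fletter (e j)) - lincomb (fun l => fletter (e l)) c.
Proof.
by move=> E; rewrite /prel tprecE -E lincombK /lcomb lincomb_push.
Qed.

Lemma srel_push i j c ws : lincomb x c = (x i ≻ x j) ->
  srel tsucc (e i) (e j) ws =
  (fletter (e i) ≻ prec_chain (fletter (e j)) ws)
  - prec_chain (lincomb (fun l => fletter (e l)) c) ws.
Proof.
by move=> E; rewrite /srel tsuccE -E lincombK /lcomb lincomb_push.
Qed.

Lemma table_relP (f : L) : table_rel x e f <->
  exists i j, f = prel tprec (e i) (e j) \/ f = srel tsucc (e i) (e j) [::].
Proof.
split=> [[i [j [c [[E ->]|[E ->]]]]]|[i [j [->|->]]]].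
- by exists i, j; left; rewrite (prel_push E).
- by exists i, j; right; rewrite (srel_push _ E).
- exists i, j, (coord xB (x i ≺ x j)); left; split; first exact: coordK.
  exact: prel_push (coordK _ _).
- exists i, j, (coord xB (x i ≻ x j)); right; split; first exact: coordK.
  exact: srel_push (coordK _ _).
Qed.

Lemma prec_relP (P : nword Z -> Prop) (f : L) : prec_rel x e P f <->
  exists i j u vs, [/\ P u, forall l, u <> nletter (e l),
    forall v, v \in vs -> P v & f = srel tsucc (e i) (e j) (u :: vs)].
Proof.
split=> [[i [j [c [u [vs [E Pu ue Pvs ->]]]]]]|[i [j [u [vs [Pu ue Pvs ->]]]]]].
- exists i, j, u, vs; split; [exact: Pu|exact: ue|exact: Pvs|].
  by rewrite (srel_push _ E).
exists i, j, (coord xB (x i ≻ x j)), u, vs.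
split; [exact: coordK|exact: Pu|exact: ue|exact: Pvs|].
exact: srel_push (coordK _ _).
Qed.

End TransportedRelations.

Section FreeProductBasis.
Context (k : fieldType) (L1 L2 : lalgebraType k) (I J : choiceType).
Context (x : I -> L1) (y : J -> L2) (le : rel (I + J)%type).
Hypotheses (xB : is_basis x) (yB : is_basis y).
Local Notation Z := (I + J)%type.
Local Notation L := (free_lalg k Z).

Definition side (z : Z) : bool := if z is inl _ then true else false.

Definition sum_table (op1 : L1 -> L1 -> L1) (op2 : L2 -> L2 -> L2) (a b : Z) :
    {malg k[Z]} :=
  match a, b with
  | inl i, inl j => push inl (coord xB (op1 (x i) (x j)))
  | inr i, inr j => push inr (coord yB (op2 (y i) (y j)))
  | _, _ => 0
  end.

Lemma sum_table_side op1 op2 a b l : side a = side b ->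
  l \in msupp (sum_table op1 op2 a b) -> side l = side a.
Proof. by case: a b => i [] j //= _ /msupp_lincombU[m _ ->]. Qed.

Definition sum_prec := sum_table lprec lprec.
Definition sum_succ := sum_table lsucc lsucc.

Lemma sum_table_assoc a b c : side a = side b -> side b = side c ->
  lincomb (fun l => sum_prec l c) (sum_succ a b)
  = lincomb (sum_succ a) (sum_prec b c).
Proof.
case: a b c => i [] j [] l ab bc; try discriminate ab; try discriminate bc;
  rewrite !lincomb_push.
- rewrite (push_coord inl xB _ (@lprec_linearl _ _ (x l))).
  rewrite (push_coord inl xB _ (@lsucc_linearr _ _ (x i))).
  by rewrite lsucc_lprecA.
rewrite (push_coord inr yB _ (@lprec_linearl _ _ (y l))).
rewrite (push_coord inr yB _ (@lsucc_linearr _ _ (y i))).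
by rewrite lsucc_lprecA.
Qed.

Lemma S_12E : S_12 x y = table side sum_prec sum_succ.
Proof.
have xP := table_relP (e := inl) (xB := xB)
  (tprec := sum_prec) (tsucc := sum_succ)
  (fun _ _ => erefl) (fun _ _ => erefl).
have yP := table_relP (e := inr) (xB := yB)
  (tprec := sum_prec) (tsucc := sum_succ)
  (fun _ _ => erefl) (fun _ _ => erefl).
apply/predeqP => f; split.
  case=> [/xP[i [j fE]]|/yP[i [j fE]]].
    by exists (inl i), (inl j); split; last exact: fE.
  by exists (inr i), (inr j); split; last exact: fE.
move=> [[i|i] [[j|j] [// _ fE]]]; [left; apply/xP|right; apply/yP];
  by exists i, j.
Qed.

Lemma S_allE : S_all x y le = completion le side sum_prec sum_succ.
Proof.
have xP := table_relP (e := inl) (xB := xB)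
  (tprec := sum_prec) (tsucc := sum_succ)
  (fun _ _ => erefl) (fun _ _ => erefl).
have yP := table_relP (e := inr) (xB := yB)
  (tprec := sum_prec) (tsucc := sum_succ)
  (fun _ _ => erefl) (fun _ _ => erefl).
have FxP := prec_relP (e := inl) (xB := xB) (tsucc := sum_succ)
  (fun _ _ => erefl).
have FyP := prec_relP (e := inr) (xB := yB) (tsucc := sum_succ)
  (fun _ _ => erefl).
rewrite /S_all /F_1 /F_2 S_12E; apply/predeqP => f; split.
  case=> [fS|fS|/FxP|/FyP].
  - by apply: table_completion; rewrite -S_12E; left.
  - by apply: table_completion; rewrite -S_12E; right.
  - move=> [i [j [u [vs [Pu ue Pvs ->]]]]]; exists (inl i), (inl j).
    split; first exact: erefl.
    right; exists (u :: vs); last exact: erefl.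
    split=> [v|[l|l] // _ [/ue]//].
    by rewrite inE => /orP[/eqP->|/Pvs].
  move=> [i [j [u [vs [Pu ue Pvs ->]]]]]; exists (inr i), (inr j).
  split; first exact: erefl.
  right; exists (u :: vs); last exact: erefl.
  split=> [v|[l|l] // _ [/ue]//].
  by rewrite inE => /orP[/eqP->|/Pvs].
move=> [[i|i] [[j|j] [// _ [->|[[|u vs] [Pu ue] ->]]]]].
- by constructor 1; apply/xP; exists i, j; left.
- by constructor 1; apply/xP; exists i, j; right.
- constructor 3; apply/FxP; exists i, j, u, vs; split=> [|l ul|v vvs|].
  + by apply: Pu; rewrite mem_head.
  + by apply: (ue (inl l)) => //; rewrite /= ul.
  + by apply: Pu; rewrite inE vvs orbT.
  + exact: erefl.
- by constructor 2; apply/yP; exists i, j; left.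
- by constructor 2; apply/yP; exists i, j; right.
constructor 4; apply/FyP; exists i, j, u, vs; split=> [|l ul|v vvs|].
+ by apply: Pu; rewrite mem_head.
+ by apply: (ue (inr l)) => //; rewrite /= ul.
+ by apply: Pu; rewrite inE vvs orbT.
+ exact: erefl.
Qed.

End FreeProductBasis.

Theorem theorem5p3 (k : fieldType) (L1 L2 : lalgebraType k) (I J : choiceType)
    (x : I -> L1) (y : J -> L2) (le : rel (I + J)%type) :
  is_basis x -> is_basis y -> well_order le ->
  [/\ presents_free_product x y,
      GS_basis le (S_all x y le) &
      forall f, Id (S_all x y le) f <-> Id (S_12 x y) f].
Proof.
move=> xB yB _; rewrite (S_allE le xB yB); split.
- exact: S_12_presents xB yB.
- by apply: completion_GS; [exact: sum_table_side..|exact: sum_table_assoc].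
by rewrite (S_12E xB yB); exact: Id_completion.
Qed.
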